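(* Let $X$ be a paracompact (Hausdorff) space of point-countable type, and let $\mathbb I=[0,1]$. The following conditions are equivalent: (i) $X$ is locally compact; (ii) $X=\bigoplus_{i\in\kappa}X_i$ is a topological sum in which all $X_i$ are Lindelöf locally compact spaces; (iii) $C_k(X)$ is a $k_{\mathbb R}$-space; (iv) $C_k(X)$ is an Ascoli space; (v) $C_k(X,\mathbb I)$ is a $k_{\mathbb R}$-space; (vi) $C_k(X,\mathbb I)$ is an Ascoli space. Moreover, if these conditions hold, then each of the spaces $C_k(X)$ and $C_k(X,\mathbb I)$ is homeomorphic to a product of a family of completely metrizable spaces.
   Context: For Tychonoff spaces $X,Y$, $C_k(X,Y)$ is the set of all continuous functions from $X$ to $Y$ with the compact-open topology, and $C_k(X)=C_k(X,\mathbb R)$. A Tychonoff space $Y$ is called Ascoli if every compact subset $\mathcal K$ of $C_k(Y)$ is evenly continuous, i.e. the evaluation map $Y\times\mathcal K\to\mathbb R$, $(y,f)\mapsto f(y)$, is continuous. A space $Y$ is a $k_{\mathbb R}$-space if a function $f:Y\to\mathbb R$ is continuous whenever its restriction to every compact subset of $Y$ is continuous. A space $X$ is of point-countable type if for every $x\in X$ there is a compact $K\subseteq X$ containing $x$ which has a countable base of neighborhoods, i.e. there are open sets $U_n\supseteq K$ ($n<\omega$) such that every open $O\supseteq K$ contains some $U_n$. *)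

(* Defs.v *)
From HB Require Import structures.
From mathcomp Require Import all_boot all_order all_algebra.
From mathcomp Require Import all_classical all_reals all_analysis.

Set Implicit Arguments.
Unset Strict Implicit.
Unset Printing Implicit Defensive.

Import Order.TTheory GRing.Theory Num.Theory.
Import numFieldNormedType.Exports.
Local Open Scope classical_set_scope.
Local Open Scope ring_scope.

Definition homeomorphic (X Y : topologicalType) : Prop :=
  exists (f : X -> Y) (g : Y -> X),
    [/\ cancel f g, cancel g f, continuous f & continuous g].

Definition open_cover (X : topologicalType) (C : set (set X)) : Prop :=
  C `<=` open /\ \bigcup_(U in C) U = [set: X].

Definition refines (X : Type) (D C : set (set X)) : Prop :=
  forall V, D V -> exists2 U, C U & V `<=` U.

Definition locally_finite (X : topologicalType) (D : set (set X)) : Prop :=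
  forall x : X, exists2 N, nbhs x N & finite_set [set V | D V /\ V `&` N !=set0].

(* No separation axiom is built in. *)
Definition paracompact (X : topologicalType) : Prop :=
  forall C : set (set X), open_cover C ->
    exists D : set (set X), [/\ open_cover D, refines D C & locally_finite D].

Definition lindelof (X : topologicalType) : Prop :=
  forall C : set (set X), open_cover C ->
    exists D : set (set X), [/\ D `<=` C, countable D & open_cover D].

Definition point_countable_type (X : topologicalType) : Prop :=
  forall x : X, exists K : set X, [/\ compact K, K x &
    exists U : nat -> set X,
      (forall n, open (U n) /\ K `<=` U n) /\
      (forall O : set X, open O -> K `<=` O -> exists n, U n `<=` O)].

Section function_space.
Import ArrowAsCompactOpen.

Definition Ck (X Y : topologicalType) : topologicalType := continuousType X Y.

End function_space.

Definition unit_interval (R : realType) : topologicalType :=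
  set_type (`[0, 1]%classic : set R).

Section real_valued.
Variable R : realType.

Definition kR_space (Y : topologicalType) : Prop :=
  forall f : Y -> R,
    (forall K : set Y, compact K -> {within K, continuous f}) -> continuous f.

Definition evenly_continuous (Y : topologicalType) (K : set (Ck Y R)) : Prop :=
  continuous (fun p : Y * set_type K => (\val p.2 : continuousType Y R) p.1).

(* For use on Tychonoff spaces [Y]; [Ck X Y] is Tychonoff when [Y] is. *)
Definition ascoli (Y : topologicalType) : Prop :=
  forall K : set (Ck Y R), compact K -> evenly_continuous K.

(* Completeness is spelled out because the library's complete spaces are
   required to be pointed. *)
Definition completely_metrizable (Y : topologicalType) : Prop :=
  exists M : metricType R,
    (forall F : set_system M, ProperFilter F -> cauchy F -> exists l : M, F --> l) /\
    homeomorphic Y M.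

Definition product_of_completely_metrizable (Y : topologicalType) : Prop :=
  exists (I : Type) (Z : I -> topologicalType),
    (forall i, completely_metrizable (Z i)) /\
    homeomorphic Y (prod_topology Z).

End real_valued.

Definition sum_of_lindelof_locally_compact (X : topologicalType) : Prop :=
  exists (I : choiceType) (Z : I -> topologicalType),
    (forall i, lindelof (Z i) /\ locally_compact [set: Z i]) /\
    homeomorphic X {i & Z i}.

(* Main.v *)
Require Import Defs.
From HB Require Import structures.
From mathcomp Require Import all_boot all_order all_algebra.
From mathcomp Require Import all_classical all_reals all_analysis.
From mathcomp Require Import lra.

Import Order.TTheory GRing.Theory Num.Theory.
Import numFieldNormedType.Exports.
Local Open Scope classical_set_scope.
Local Open Scope ring_scope.
Set Implicit Arguments.
Unset Strict Implicit.
Unset Printing Implicit Defensive.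

(** A locally compact paracompact space splits into clopen sigma-compact pieces
    (chains of members of a locally finite cover by relatively compact open
    sets), so [C_k(X)] is the product of the [C_k] of the pieces, each of which
    is completely metrizable.  A product of first countable spaces is a
    [k_R]-space: at a discontinuity one finds points tending to [x] that differ
    from [x] on finite sets only, chosen one after the other so that they
    converge; together with [x] they form a compact set on which the function
    is discontinuous.  A [k_R]-space is Ascoli, since for compact [K] the
    function [y |-> sup_{f in K} |f y - f y0|] is continuous on compact sets.

    Conversely, suppose that [X] is not locally compact at a point of a compact
    [K] with decreasing neighbourhood base [U_n].  As [X] is paracompact, every
    [U_n] contains points [x_{n,k}] that have a locally finite sequence of
    neighbourhoods [W_{n,k}] disjoint from [K]; let [phi_{n,k}] be a bump
    function at [x_{n,k}] supported in [W_{n,k}].  The functions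
    [a_{n,k} = max(phi_{n,k}, phi_{k,0} / (n+1))] accumulate at [0].  A compact
    set of functions oscillates little near [K], so the first term prevents it
    from coming close to [a_{n,k}] for infinitely many [n], and the second term
    prevents it, for a fixed [n], for infinitely many [k].  Hence bump functions
    [F_{n,k}] around the [a_{n,k}] in [C_k(X, [0,1])] converge to [0] in its
    [C_k], while [F_{n,k}(a_{n,k}) >= 1], so [C_k(X, [0,1])] is not Ascoli. *)

(** * The compact-open topology *)

Section Ck_topology.
Variables X Y : topologicalType.
Implicit Types f g : Ck X Y.

Definition ckfun (f : Ck X Y) : X -> Y := (f : continuousType X Y).
Definition ck (f : X -> Y) (cf : continuous f) : Ck X Y := (mkcts cf : continuousType X Y).

Lemma ckE (f : X -> Y) (cf : continuous f) : ckfun (ck cf) = f.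
Proof. by []. Qed.

Lemma ckfun_continuous f : continuous (ckfun f).
Proof. by move=> x; exact: cts_fun. Qed.

Lemma ckP f g : ckfun f =1 ckfun g -> f = g.
Proof. by move=> fg; apply/continuousEP. Qed.

(** Neighbourhoods in [Ck X Y] are preimages of neighbourhoods in the compact-open space of all
    functions, so the convergence criterion there carries over. *)
Lemma Ck_cvgP (F : set_system (Ck X Y)) {FF : Filter F} f :
  F --> f <-> forall K O, compact K -> open O -> ckfun f @` K `<=` O ->
    F [set g | ckfun g @` K `<=` O].
Proof.
split.
  move=> Ff K O cK oO fKO; apply: Ff.
  rewrite nbhsE/=; exists [set g | ckfun g @` K `<=` O] => //; split => //.
  exists [set g : {compact-open, X -> Y} | g @` K `<=` O] => //.
  exact: compact_open_open.
move=> H A.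
have : (ckfun @ F : set_system {compact-open, X -> Y}) --> (ckfun f : {compact-open, X -> Y}).
  apply/compact_open_cvgP => K O cK oO fKO; exact: H.
move=> H1.
rewrite nbhsE => -[B [[C oC <-] Cf]] /filterS; apply.
apply: (H1 C); exact: open_nbhs_nbhs.
Qed.

Lemma Ck_nbhs f K O : compact K -> open O -> ckfun f @` K `<=` O ->
  nbhs f [set g | ckfun g @` K `<=` O].
Proof.
move=> cK oO fKO; have /(Ck_cvgP f) : nbhs f --> f by exact: cvg_id.
exact.
Qed.

Lemma Ck_eval_continuous x : continuous (fun f => ckfun f x).
Proof.
move=> f A; rewrite nbhsE => -[ O [oO Ofx] OA].
have /(Ck_nbhs (@compact_set1 _ x) oO) : ckfun f @` [set x] `<=` O.
  by move=> _ [_ -> <-].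
apply: filterS => g /= gO.
by apply: OA; apply: gO; exists x.
Qed.

Lemma Ck_continuous_atP (T : topologicalType) (h : T -> Ck X Y) (t : T) :
  {for t, continuous h} <-> forall K O, compact K -> open O ->
    ckfun (h t) @` K `<=` O -> nbhs t [set s | ckfun (h s) @` K `<=` O].
Proof. exact: (@Ck_cvgP (h @ nbhs t) (fmap_filter h (@nbhs_filter T t)) (h t)). Qed.

End Ck_topology.

Lemma Ck_comp_continuous (X X' Y Y' : topologicalType) (u : X' -> X) (v : Y -> Y')
  (cu : continuous u) (cv : continuous v) (h : Ck X Y -> Ck X' Y') :
  (forall f, ckfun (h f) =1 v \o ckfun f \o u) -> continuous h.
Proof.
move=> hE f; apply/Ck_continuous_atP => K O cK oO fKO.
have cuK : compact (u @` K).
  by apply: continuous_compact => //; apply: continuous_subspaceT.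
have ovO : open (v @^-1` O) by apply: open_comp => // y _; exact: cv.
have : ckfun f @` (u @` K) `<=` v @^-1` O.
  by move=> _ [_ [x Kx <-] <-]; apply: fKO; exists x => //; rewrite hE.
move=> /(Ck_nbhs cuK ovO); apply: filterS => g gO _ [x Kx <-].
by rewrite hE/=; apply: gO; exists (u x) => //; exists x.
Qed.

(** * Uniform convergence on compact sets *)

Section metric_embedding.
Variable R : realType.

Lemma cvg_distP (T : Type) (F : set_system T) {FF : Filter F} (f : T -> R) (l : R) :
  f @ F --> l <-> forall e : R, 0 < e -> F [set t | `|l - f t| < e].
Proof. exact: cvgrPdist_lt. Qed.

Lemma continuous_at_distP (T : topologicalType) (f : T -> R) (x : T) :
  {for x, continuous f} <->
  forall e : R, 0 < e -> nbhs x [set y | `|f x - f y| < e].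
Proof. exact: cvgrPdist_lt. Qed.

(* Treats the targets [R] (with [e := id]) and [[0, 1]] (with [e := val]) at
   once. *)
Definition ball_embedding (Y : topologicalType) (e : Y -> R) :=
  forall y A, nbhs y A <-> exists2 r : R, 0 < r & [set z | `|e y - e z| < r] `<=` A.

Lemma ball_embedding_id : ball_embedding (@id R).
Proof.
move=> y A; split; first by move=> /nbhs_ballP[r r0 rA]; exists r.
by move=> [r r0 rA]; apply/nbhs_ballP; exists r.
Qed.

Lemma ball_embedding_val (S : set R) : ball_embedding (val : set_type S -> R).
Proof.
move=> y A; split.
  rewrite nbhsE => -[B [[C oC <-] Cy] BA].
  have /nbhs_ballP[r r0 rC] : nbhs (val y) C by exact: open_nbhs_nbhs.
  by exists r => // z zr; apply: BA; apply: rC.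
move=> [r r0 rA]; have : nbhs (val y) (ball (val y) r) by exact: nbhsx_ballx.
rewrite nbhsE => -[B [oB By] BA].
rewrite nbhsE; exists (val @^-1` B); first by split => //; exists B.
by move=> z /= Bz; apply: rA; exact: BA.
Qed.

Variables (X Y : topologicalType) (e : Y -> R).
Hypothesis ye : ball_embedding e.

Lemma ball_embedding_continuous : continuous e.
Proof.
move=> y A /nbhs_ballP[r r0 rA]; apply/ye; exists r => // z zr; exact: rA.
Qed.

Lemma Ck_nbhs_ballP (f : Ck X Y) (A : set (Ck X Y)) :
  nbhs f A <-> exists K, exists2 r : R, compact K /\ 0 < r &
    [set g : Ck X Y | forall x, K x -> `|e (ckfun f x) - e (ckfun g x)| < r] `<=` A.
Proof.
have cef (g : Ck X Y) : continuous (e \o ckfun g).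
  move=> x; apply: continuous_comp; first exact: ckfun_continuous.
  exact: ball_embedding_continuous.
pose U (K : set X) (r : R) :=
  [set g : Ck X Y | forall x, K x -> `|e (ckfun f x) - e (ckfun g x)| < r].
split.
  pose F : set_system (Ck X Y) :=
    [set A | exists K, exists2 r : R, compact K /\ 0 < r & U K r `<=` A].
  have FF : Filter F.
    split.
    - by exists set0; exists 1 => //; split => //; exact: compact0.
    - move=> P Q [K [r [cK r0] UP]] [L [s [cL s0] UQ]].
      exists (K `|` L); exists (Num.min r s).
        by split; [exact: compactU | rewrite lt_min r0 s0].
      move=> g Ug; split; [apply: UP|apply: UQ] => x Kx.
        by have := Ug x (or_introl Kx); rewrite lt_min => /andP[].
      by have := Ug x (or_intror Kx); rewrite lt_min => /andP[].
    - move=> P Q PQ [K [r Kr UP]]; exists K; exists r => //.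
      exact: subset_trans PQ.
  have : F --> f.
    apply/Ck_cvgP => K O cK oO fKO.
    (* Compactness of [K] yields one radius [r] that works at all points of [K], as with a Lebesgue
       number. *)
    have H : \forall r \near 0^'+, K `<=` [set x | forall z, `|e (ckfun f x) - e z| < r -> O z].
      have := (@compact_near_coveringP X K).1 cK.
      apply => x Kx.
      have /ye[r r0 rO] : nbhs (ckfun f x) O.
        by apply: open_nbhs_nbhs; split => //; apply: fKO; exists x.
      have r20 : 0 < r / 2 by rewrite divr_gt0.
      exists ([set x' | `|e (ckfun f x) - e (ckfun f x')| < r / 2], [set s | s < r / 2]).
        split => /=.
          by have /cvgrPdist_lt/(_ _ r20) := cef f x.
        exact: nbhs_right_lt.
      move=> -[x' s]/= [h1 h2] z h3; apply: rO => /=.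
      rewrite (splitr r) (le_lt_trans (ler_distD (e (ckfun f x')) _ _))//.
      by rewrite ltrD// (lt_trans h3).
    near (0:R)^'+ => r.
    exists K; exists r; first by split.
    move=> g Ug _ [x Kx <-].
    have : K `<=` [set x | forall z, `|e (ckfun f x) - e z| < r -> O z] by near: r.
    by move=> /(_ x Kx); apply; exact: Ug.
  by move=> H /H.
move=> [K [r [cK r0] UA]]; apply: (filterS UA).
have := (@compact_near_coveringP X K).1 cK => /near_covering_withinP.
move=> /(_ (Ck X Y) (nbhs f) (fun g x => `|e (ckfun f x) - e (ckfun g x)| < r)); apply.
move=> x Kx.
have r30 : 0 < r / 3 by rewrite divr_gt0.
have r20 : 0 < r / 2 by rewrite divr_gt0.
(* The inequality in [C] is not strict, so [C] is closed and the trace of [K] on it is compact.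
   There [f] stays within r/3 and nearby [g] within r/2 of the value at [x], which sums to less than
   [r]. *)
pose C := [set x' | `|e (ckfun f x) - e (ckfun f x')| <= r / 3].
have clC : closed C.
  apply: (@preimage_closed _ _ (e \o ckfun f) (closed_ball_ Num.norm (e (ckfun f x)) (r / 3))).
    by move=> z _; exact: cef.
  exact: closed_closed_ball_.
have cKC := compact_closedI cK clC.
pose O := e @^-1` ball (e (ckfun f x)) (r / 2).
have oO : open O.
  apply: open_comp; last exact: ball_open.
  by move=> y _; exact: ball_embedding_continuous.
have := @Ck_nbhs _ _ f (K `&` C) O cKC oO.
move=> H; exists (C, [set g | ckfun g @` (K `&` C) `<=` O]).
  split => /=.
    have /cvgrPdist_lt/(_ _ r30) := cef f x.
    by apply: filterS => y /ltW.
  apply: H => _ [y [Ky Cy] <-]; rewrite /O /ball/= (le_lt_trans Cy)//.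
  by rewrite ltr_pM2l// ltf_pV2 ?posrE// ltr_nat.
move=> -[x' g]/= [Cx' gO] Kx'.
rewrite (le_lt_trans (ler_distD (e (ckfun f x)) _ _))//.
have h2 : `|e (ckfun f x) - e (ckfun g x')| < r / 2.
  by apply: gO; exists x'.
rewrite [ltRHS]splitr ler_ltD// distrC (le_trans Cx')//.
by rewrite ler_pM2l// lef_pV2 ?posrE// ler_nat.
Unshelve. all: by end_near. Qed.

(** A three-epsilon argument: functions uniformly close to [f] on [C] oscillate at [x] little more
    than [f] does, and compactness of [K] makes the neighbourhood of [x] independent of [f]. Points
    stay in [C] because closeness in [Ck X Y] is uniform on compact sets only. *)
Lemma compact_equicontinuous_within (K : set (Ck X Y)) (C : set X) (x : X) (r : R) :
  compact K -> compact C -> C x -> 0 < r ->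
  within C (nbhs x) [set x' | K `<=` [set f | `|e (ckfun f x) - e (ckfun f x')| < r]].
Proof.
move=> cK cC Cx r0.
have r30 : 0 < r / 3 by rewrite divr_gt0.
apply: ((compact_near_coveringP K).1 cK _ (within C (nbhs x))
  (fun x' f => `|e (ckfun f x) - e (ckfun f x')| < r)) => f Kf.
exists ([set g | forall z, C z -> `|e (ckfun f z) - e (ckfun g z)| < r / 3],
   [set x' | C x' /\ `|e (ckfun f x) - e (ckfun f x')| < r / 3]).
  split => /=; first by apply/Ck_nbhs_ballP; exists C, (r / 3).
  have cef : {for x, continuous (e \o ckfun f)}.
    apply: continuous_comp; first exact: ckfun_continuous.
    exact: ball_embedding_continuous.
  have := (continuous_at_distP _ _).1 cef _ r30.
  by rewrite /within/=; apply: filterS => x' xx' Cx'; split.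
move=> [g x']/= [fg [Cx' xx']].
have := fg _ Cx; have := fg _ Cx'; move: xx'.
move: (e (ckfun f x)) (e (ckfun f x')) (e (ckfun g x)) (e (ckfun g x')) => a b c d.
rewrite !ltr_norml => /andP[? ?] /andP[? ?] /andP[? ?].
by apply/andP; split; lra.
Qed.

End metric_embedding.

(** * Compactness and paracompactness *)

Lemma filter_finite_forall (T I : Type) (F : set_system T) {FF : Filter F}
    (E : set I) (P : I -> set T) :
  finite_set E -> (forall i, E i -> F (P i)) ->
  F [set t | forall i, E i -> P i t].
Proof.
move=> /(@finite_seqP {classic I})[s ->]; elim: s => [|i s ih] FP.
  by apply: filterS filterT => t _ i.
have Fi : F (P i) by apply: FP; rewrite /= inE eqxx.
have Fs : F [set t | forall i, i \in s -> P i t].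
  by apply: ih => j /= js; apply: FP; rewrite /= inE js orbT.
apply: filterS (filterI Fi Fs) => t [Pit Pst] j /=.
by rewrite inE => /orP[/eqP ->//|]; exact: Pst.
Qed.

Section compact_covers.
Variable X : topologicalType.

Lemma compact_finite_cover (I : Type) (D : set I) (U : I -> set X) (K : set X) :
  compact K -> (forall x, K x -> exists2 i, D i & nbhs x (U i)) ->
  exists2 E, finite_set E /\ E `<=` D & K `<=` \bigcup_(i in E) U i.
Proof.
move=> /compact_near_coveringP cK KU.
(* Tails of the finite subsets of [D] ordered by inclusion: for every [x] in [K], all sufficiently
   large [E'] work near [x]. *)
pose F := filter_from [set E | finite_set E /\ E `<=` D]
  (fun E => [set E' : set I | E `<=` E' /\ E' `<=` D]).
have FF : Filter F.
  apply: filter_from_filter; first by exists set0; split.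
  move=> A B [fA AD] [fB BD]; exists (A `|` B).
    by split; [rewrite finite_setU | rewrite subUset].
  by move=> E' [/= ABE' E'D]; split; split => // i Ai; apply: ABE'; [left|right].
have [x Kx|E [fE ED] EP] := cK _ F (fun E x => exists2 i, E i & U i x) FF.
  have [i Di Ui] := KU x Kx.
  exists (U i, [set E' : set I | [set i] `<=` E' /\ E' `<=` D]).
    split => //=; exists [set i] => //; split => //.
    by move=> _ ->.
  by move=> -[x' E']/= [Ux' [iE' _]]; exists i => //; exact: iE'.
exists E => // x Kx.
by have [i Ei Ui] := EP E (conj (fun _ => id) ED) x Kx; exists i.
Qed.

(** Here the finite sets [E] themselves serve as indices of the cover. Used for locally finite
    families and for compact subsets of topological sums. *)
Lemma compact_finite_relation (I : Type) (Q : X -> set I) (K : set X) :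
  compact K ->
  (forall x, K x -> exists2 E, finite_set E & \forall x' \near x, Q x' `<=` E) ->
  finite_set (\bigcup_(x in K) Q x).
Proof.
move=> cK KQ.
have [EE [fEE EEf] KEE] := compact_finite_cover (D := finite_set)
  (U := fun E => [set x | Q x `<=` E]) cK KQ.
apply: (@sub_finite_set _ _ (\bigcup_(E in EE) E)); last exact: bigcup_finite.
by move=> i [x Kx Qxi]; have [E EEE QE] := KEE _ Kx; exists E => //; exact: QE.
Qed.

Lemma finite_bigcup_compact (I : Type) (E : set I) (K : I -> set X) :
  finite_set E -> (forall i, E i -> compact (K i)) -> compact (\bigcup_(i in E) K i).
Proof.
move=> /(@finite_seqP {classic I})[s ->]; elim: s => [|i s ih] cK.
  rewrite (_ : \bigcup_(i in _) K i = set0); first exact: compact0.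
  by rewrite -subset0 => x [].
have -> : \bigcup_(j in [set` i :: s]) K j = K i `|` \bigcup_(j in [set` s]) K j.
  apply/seteqP; split => x.
    move=> [j /=]; rewrite inE => /orP[/eqP ->|js Kx]; first by left.
    by right; exists j.
  move=> [Kx|[j /= js Kx]]; [exists i => //=|exists j => //=].
    by rewrite inE eqxx.
  by rewrite inE js orbT.
apply: compactU.
  by apply: cK; rewrite /= inE eqxx.
by apply: ih => j /= js; apply: cK; rewrite /= inE js orbT.
Qed.

(** If a filter on [C] has no cluster point in [K], finitely many of its members have closures whose
    intersection misses [K]. The complement of that intersection is an admissible [O], so the filter
    lives on the compact [C']. Applied to sequences that converge to a point or to a compact set. *)
Lemma compact_of_compact_nbhs_complement (K C : set X) : compact K -> K `<=` C ->
  (forall O, open O -> K `<=` O -> exists2 C', compact C' & C `\` O `<=` C' /\ C' `<=` C) ->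
  compact C.
Proof.
move=> cK KC H F PF FC; apply: contrapT => nC.
have KF x : K x -> exists2 S, F S & nbhs x (~` closure S).
  move=> Kx; have : ~ cluster F x.
    by move=> clx; apply: nC; exists x; split => //; exact: KC.
  rewrite clusterE => /existsNP[S /not_implyP[FS nSx]]; exists S => //.
  apply: open_nbhs_nbhs; split => //.
  exact/closed_openC/closed_closure.
have [E [fE EF] KE] := compact_finite_cover (D := F) (U := fun S => ~` closure S) cK KF.
have oO : open (\bigcup_(S in E) ~` closure S).
  by apply: bigcup_open => S _; exact/closed_openC/closed_closure.
have [C' cC' [CC' C'C]] := H _ oO KE.
have FC' : F C'.
  have FE : F [set t | forall S, E S -> S t] by exact: (@filter_finite_forall X (set X) F _ E id).
  apply: filterS (filterI FC FE) => t [Ct Et]; apply: CC'; split => //.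
  by move=> [S ES]; apply; apply: subset_closure; exact: Et.
have [x [C'x clx]] := cC' F PF FC'.
by apply: nC; exists x; split => //; exact: C'C.
Qed.

End compact_covers.

Section paracompactness.
Variable X : topologicalType.
Implicit Types (A B C K L : set X) (D : set (set X)).

Lemma compact_locally_finite D K : locally_finite D -> compact K ->
  finite_set [set V | D V /\ V `&` K !=set0].
Proof.
move=> lfD cK.
have := @compact_finite_relation X _ (fun x V => D V /\ V x) K cK.
rewrite (_ : \bigcup_(x in K) _ = [set V | D V /\ V `&` K !=set0]).
  apply=> x Kx; have [N Nx fN] := lfD x; exists [set V | D V /\ V `&` N !=set0] => //.
  apply: filterS Nx => y Ny V [DV Vy]; split => //.
  by exists y.
apply/seteqP; split.
  by move=> V [x Kx [DV Vx]]; split => //; exists x.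
by move=> V [DV [x [Vx Kx]]]; exists x.
Qed.

(** A neighbourhood of [b] meets only finitely many members, and each of these can be avoided by
    shrinking it. *)
Lemma locally_finite_closure D b : locally_finite D ->
  (forall V, D V -> ~ closure V b) -> ~ closure (\bigcup_(V in D) V) b.
Proof.
move=> lfD DN clb; have [N Nb fN] := lfD b.
pose E := [set V | D V /\ V `&` N !=set0].
have : nbhs b [set t | forall V, E V -> ~ V t].
  apply: filter_finite_forall => // V [DV _].
  have : nbhs b (~` closure V).
    apply: open_nbhs_nbhs; split; first exact/closed_openC/closed_closure.
    exact: DN.
  by apply: filterS => t nVt Vt; apply: nVt; exact: subset_closure.
move=> nE; have [t [[V DV Vt] [nEt Nt]]] := clb _ (filterI nE Nb).
by apply: (nEt V) => //; split => //; exists t.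
Qed.

Hypothesis paraX : paracompact X.

(** Refine the cover by the complement of [A] and the open sets whose closure misses [B]. Members
    that meet [A] have closures missing [B], and local finiteness passes this on to their union.
    With [B] a point this gives regularity, with [B] closed normality. *)
Lemma paracompact_closure_separation A B : closed A ->
  (forall a, A a -> exists2 U, open U /\ U a & B `&` closure U = set0) ->
  exists2 V, open V /\ A `<=` V & B `&` closure V = set0.
Proof.
move=> clA sepA.
pose C := [set U | open U /\ (U = ~` A \/ B `&` closure U = set0)].
have [|D [[Dop DT] DC lfD]] := @paraX C.
  split; first by move=> U [].
  rewrite -subTset => x _; have [Ax|nAx] := pselect (A x).
    by have [U [oU Ux] BU] := sepA x Ax; exists U => //; split => //; right.
  by exists (~` A) => //; split; [exact: closed_openC|left].
pose D' := [set V | D V /\ V `&` A !=set0].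
have lfD' : locally_finite D'.
  move=> x; have [N Nx fN] := lfD x; exists N => //.
  by apply: sub_finite_set fN => V [[DV _] VN].
exists (\bigcup_(V in D') V).
  split; first by apply: bigcup_open => V [DV _]; exact: Dop.
  move=> a Aa; have : [set: X] a by [].
  by rewrite -DT => -[V DV Va]; exists V => //; split => //; exists a.
rewrite -subset0 => b [Bb]; apply: locally_finite_closure => // V [DV [a [Va Aa]]].
have [U [_ [UA|BU]] VU] := DC V DV; first by have := VU a Va; rewrite UA.
by move=> /(closureS VU) Ub; rewrite -[False]/(set0 b) -BU.
Qed.

Hypothesis hausX : hausdorff_space X.

Lemma paracompact_regular_closure A b : closed A -> ~ A b ->
  exists2 V, open V /\ A `<=` V & ~ closure V b.
Proof.
move=> clA nAb.
have [|V VP bV] := @paracompact_closure_separation A [set b] clA.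
  move=> a Aa; have ab : a != b by apply/eqP => ab; apply: nAb; rewrite -ab.
  have := hausX; rewrite open_hausdorff => /(_ a b ab)[[U W]/= [Ua Wb] [oU oW UW]].
  exists U; first by split => //; exact: set_mem.
  rewrite -subset0 => _ [-> clU].
  have [y [Uy Wy]] := clU W (open_nbhs_nbhs (conj oW (set_mem Wb))).
  by have : (U `&` W) y by []; rewrite (eqP UW).
exists V => // clb; have : ([set b] `&` closure V) b by split.
by rewrite bV.
Qed.

Lemma paracompact_normal : normal_space X.
Proof.
move=> A clA B /set_nbhsP[ O [oO AO OB]].
have clO : closed (~` O) by exact: open_closedC.
have [|V [oV AV] OV] := @paracompact_closure_separation A (~` O) clA.
  move=> a Aa; have [|W [oW OW] nWa] := @paracompact_regular_closure (~` O) a clO.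
    by move=> nOa; exact/nOa/AO.
  exists (~` closure W).
    by split => //; exact/closed_openC/closed_closure.
  rewrite -subset0 => y [nOy clWy].
  have [z [nWz Wz]] := clWy W (open_nbhs_nbhs (conj oW (OW _ nOy))).
  by apply: nWz; exact: subset_closure.
exists V; first by apply/set_nbhsP; exists V; split => // y.
move=> y Vy; apply: OB; apply: contrapT => nOy.
by have : (~` O `&` closure V) y by []; rewrite OV.
Qed.

Lemma paracompact_closed_nbhs (x : X) (U : set X) : nbhs x U ->
  exists V : set X, [/\ nbhs x V, closed V & V `<=` U].
Proof.
move=> Ux; have : nbhs x U by []; rewrite {1}nbhsE => -[ O [oO Ox] OU].
have [|W [oW OW] nWx] := @paracompact_regular_closure (~` O) x (open_closedC oO).
  by apply.
exists (~` W); split.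
- have : nbhs x (~` closure W).
    by apply: open_nbhs_nbhs; split => //; exact/closed_openC/closed_closure.
  by apply: filterS => y nWy Wy; apply: nWy; exact: subset_closure.
- exact: open_closedC.
- by move=> y nWy; apply: OU; apply: contrapT => /OW.
Qed.

(** Take a filter containing [L] without cluster point in [L], and refine the cover by the
    complement of [L] and the open sets that miss some member of the filter. If only finitely many
    sets of the refinement met [L], a member of the filter would avoid them all. *)
Lemma noncompact_locally_finite L : closed L -> ~ compact L ->
  exists D, [/\ D `<=` open, locally_finite D &
    infinite_set [set V | D V /\ V `&` L !=set0]].
Proof.
move=> clL ncL.
have [F PF [FL nL]] : exists2 F : set_system X, ProperFilter F & F L /\ L `&` cluster F = set0.
  apply: contrapT => nF; apply: ncL => F PF FL; apply: contrapT => /set0P nLF.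
  by apply: nF; exists F => //; split => //; apply/eqP; move/negP: nLF; rewrite negbK.
pose C := [set U | open U /\ (U = ~` L \/ exists2 S, F S & U `&` S = set0)].
have [|D [[Dop DT] DC lfD]] := @paraX C.
  split; first by move=> U [].
  rewrite -subTset => x _; have [Lx|nLx] := pselect (L x); last first.
    by exists (~` L) => //; split; [exact: closed_openC|left].
  have : ~ cluster F x by move=> Fx; rewrite -[False]/(set0 x) -nL.
  rewrite clusterE => /existsNP[S /not_implyP[FS nSx]].
  exists (~` closure S) => //; split; first exact/closed_openC/closed_closure.
  right; exists S => //; rewrite -subset0 => y [nSy Sy]; apply: nSy.
  exact: subset_closure.
exists D; split => // fD.
have : F [set t | forall V, (D V /\ V `&` L !=set0) -> ~ V t].
  apply: filter_finite_forall => // V [DV [x [Vx Lx]]].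
  have [U [_ [UL|[S FS US]]] VU] := DC V DV.
    by have := VU _ Vx; rewrite UL.
  apply: filterS FS => t St Vt; rewrite -[False]/(set0 t) -US.
  by split => //; exact: VU.
move=> FD; have [t [Lt nDt]] := filter_ex (filterI FL FD).
have : [set: X] t by [].
rewrite -DT => -[V DV Vt]; apply: (nDt V) => //; split => //.
by exists t.
Qed.

Lemma noncompact_discrete_sequence L K : closed L -> ~ compact L -> compact K ->
  exists (W : nat -> set X) (x : nat -> X),
    (forall k, [/\ open (W k), W k (x k), L (x k) & W k `&` K = set0]) /\
    (forall C, compact C -> finite_set [set k | W k `&` C !=set0]).
Proof.
move=> clL ncL cK; have [D [Dop lfD iD]] := noncompact_locally_finite clL ncL.
have fK := compact_locally_finite lfD cK.
(* Only finitely many members of [D] meet the compact [K]; discarding them leaves infinitely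
   many. *)
have iD' : infinite_set [set V | [/\ D V, V `&` L !=set0 & V `&` K = set0]].
  move=> fD'; apply: iD.
  have : finite_set ([set V | [/\ D V, V `&` L !=set0 & V `&` K = set0]] `|`
    [set V | D V /\ V `&` K !=set0]) by rewrite finite_setU.
  apply: sub_finite_set => V [DV VL].
  have [VK|/eqP/set0P VK] := pselect (V `&` K = set0); first by left.
  by right.
have /infiniteP/pcard_leP/unsquash W := iD'.
have WP k : [/\ D (W k), W k `&` L !=set0 & W k `&` K = set0].
  by have := @funS _ _ _ _ W k I.
have Winj : injective W by move=> i j ij; apply: (@inj _ _ _ W); rewrite ?inE.
have /choice[x xP] : forall k, exists x, W k x /\ L x.
  by move=> k; have [_ [y [Wy Ly]] _] := WP k; exists y.
exists W, x; split.
  by move=> k; have [DW _ WK] := WP k; have [Wx Lx] := xP k; split => //; exact: Dop.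
move=> C cC; have := compact_locally_finite lfD cC.
move=> /(finite_preimage (f := W)) fW.
apply: sub_finite_set (fW _) => [k Wk|i j _ _]; last exact: Winj.
by have [DW _ _] := WP k.
Qed.

End paracompactness.

(** * Products, k_R-spaces and Ascoli spaces *)

Section products.
Variables (I : Type) (Z : I -> topologicalType).

Lemma prod_cvgP (F : set_system (prod_topology Z)) {FF : Filter F} (x : prod_topology Z) :
  F --> x <-> forall i, (fun g : prod_topology Z => g i) @ F --> x i.
Proof.
split.
  move=> /cvg_sup Fx i A; rewrite nbhsE => -[ O [oO Ox] OA].
  apply: (Fx i); rewrite nbhsE; exists (fun g : prod_topology Z => O (g i)).
    by split => //; exists O.
  by move=> g Og; exact: OA.
move=> Fx; apply/cvg_sup => i A; rewrite nbhsE => -[ B [[ O oO <-] Ox] BA].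
apply: (filterS BA); apply: (Fx i); exact: open_nbhs_nbhs.
Qed.

Lemma prod_proj_continuous i : continuous (fun g : prod_topology Z => g i).
Proof. by move=> x; apply: (@prod_cvgP (nbhs x) (nbhs_filter x) x).1. Qed.

End products.

Section compactly_generated.
Variables (R : realType).

Lemma within_continuous_cvg (X Y : topologicalType) (C : set X) (f : X -> Y)
    (F : set_system X) {FF : Filter F} (x : X) :
  {within C, continuous f} -> C x -> F --> x -> F C -> f @ F --> f x.
Proof.
move=> /subspace_continuousP/(_ x) + Cx Fx FC => /(_ Cx); apply: cvg_trans.
apply: cvg_app => A; rewrite /within/= => wA.
apply: filterS (filterI FC (Fx _ wA)) => y [Cy]; exact.
Qed.

Lemma convergent_sequence_compact (X : topologicalType) (u : nat -> X) (x : X) :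
  u @ \oo --> x -> compact ([set x] `|` range u).
Proof.
move=> ux; apply: (compact_of_compact_nbhs_complement (@compact_set1 _ x)).
  exact: subsetUl.
move=> O oO xO; have /ux[N _ NO] : nbhs x O.
  by apply: open_nbhs_nbhs; split => //; exact: xO.
exists (u @` `I_N); first exact/finite_compact/finite_image/finite_II.
split.
  move=> y [[->|[n _ <-]] nOy]; first by case: nOy; exact: xO.
  exists n => //=; rewrite ltnNge; apply/negP => Nn; apply: nOy.
  exact: NO.
by move=> _ [n _ <-]; right; exists n.
Qed.

(** Eventual inclusion replaces a decreasing base: points chosen in [U n] converge to [x]. *)
Definition first_countable (X : topologicalType) := forall x : X,
  exists U : nat -> set X, (forall n, nbhs x (U n)) /\
    forall A, nbhs x A -> exists N, forall n, (N <= n)%N -> U n `<=` A.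

Lemma prod_kR_space (I : Type) (Z : I -> topologicalType) :
  (forall i, first_countable (Z i)) -> kR_space R (prod_topology Z).
Proof.
move=> fcZ f cf x; apply/continuous_at_distP => e e0; apply: contrapT => nfx.
pose U i := projT1 (cid (fcZ i (x i))).
have UP i : (forall n, nbhs (x i) (U i n)) /\
    forall A, nbhs (x i) A -> exists N, forall n, (N <= n)%N -> U i n `<=` A.
  exact: projT2 (cid (fcZ i (x i))).
have PI (G : set I) (P : forall i, set (Z i)) : finite_set G ->
    (forall i, G i -> nbhs (x i) (P i)) ->
    nbhs x [set g : prod_topology Z | forall i, G i -> P i (g i)].
  move=> fG GP.
  apply: (@filter_finite_forall _ I (nbhs x) (nbhs_filter x) G
    (fun i (g : prod_topology Z) => P i (g i)) fG) => i Gi.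
  by apply: (@prod_proj_continuous I Z i x); exact: GP.
(* The values of [f] at [z] can be approximated by modifying [x] on a finite
   set only, since [f] is continuous on the compact set [prod {x_i, z_i}]. *)
have step (nG : nat * set I) : exists zG : prod_topology Z * set I,
    finite_set nG.2 -> [/\ finite_set zG.2, (forall i, ~ zG.2 i -> zG.1 i = x i),
      (forall i, nG.2 i -> U i nG.1 (zG.1 i)) & e / 2 <= `|f x - f zG.1|].
  (* The default pair for infinite [G] only makes [step] total; the sets [G n] built below are
     finite. *)
  case: nG => n G /=; have [fG|nfG] := pselect (finite_set G); last first.
    by exists (x, set0).
  have [z zU fz] : exists2 z : prod_topology Z,
      (forall i, G i -> U i n (z i)) & e <= `|f x - f z|.
    apply: contrapT => nz; apply: nfx.
    have := PI G (fun i => U i n) fG (fun i _ => (UP i).1 n).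
    apply: filterS => z zU /=; rewrite ltNge; apply/negP => fz.
    by apply: nz; exists z.
  pose P := [set g : prod_topology Z | forall i, [set x i; z i] (g i)].
  have cP : compact P.
    apply: (@tychonoff {classic I} Z (fun i => [set x i; z i])) => i.
    exact/finite_compact/finite_set2.
  (* [g E] follows [z] on [E] and [x] elsewhere; along the finite sets [E] it tends to [z] inside
     the compact [P]. *)
  pose g (E : set I) : prod_topology Z := fun i => if pselect (E i) then z i else x i.
  pose F : set_system (set I) := filter_from finite_set
    (fun E => [set E' : set I | E `<=` E' /\ finite_set E']).
  have FF : ProperFilter F.
    apply: filter_from_proper; last by move=> E fE; exists E; split.
    apply: filter_from_filter; first by exists set0.
    move=> A B fA fB; exists (A `|` B); first by rewrite finite_setU.
    by move=> E' [ABE' fE']; split; split => // i Ai; apply: ABE'; [left|right].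
  have gz : g @ F --> z.
    apply/prod_cvgP => i A Ai; exists [set i]; first exact: finite_set1.
    move=> E [iE _].
    rewrite /= /g; case: pselect => [Ei|]; first exact: nbhs_singleton.
    by case; exact: iE.
  have Pg E : P (g E).
    by move=> i; rewrite /g; case: pselect; [right|left].
  have /cvgrPdist_lt/(_ (e / 2)) : f @ (g @ F) --> f z.
    apply: (@within_continuous_cvg _ _ P); [exact: cf| |exact: gz|].
    - by move=> i; right.
    - by exists set0 => // E _; exact: Pg.
  rewrite divr_gt0// => /(_ isT) [E fE gE].
  have {gE} : `|f z - f (g E)| < e / 2 by apply: gE; split.
  move=> gE; exists (g E, E) => _; split => //=.
  - by move=> i nEi; rewrite /g; case: pselect.
  - move=> i Gi; rewrite /g; case: pselect => Ei; first exact: zU.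
    exact: nbhs_singleton ((UP i).1 n).
  - rewrite -(lerD2r (e / 2)) -splitr (le_trans fz)//.
    by rewrite (le_trans (ler_distD (f (g E)) _ _))// lerD2l distrC ltW.
have [zG zGP] := choice step.
(* [G n] collects the coordinates changed before stage [n]; the next point must lie in [U i n] at
   each of them. *)
pose G := fix G n := if n is n'.+1 then G n' `|` (zG (n', G n')).2 else set0.
have fG n : finite_set (G n).
  elim: n => [//|n ih] /=; rewrite finite_setU; split => //.
  by have [] := zGP (n, G n) ih.
have GS n m : (n <= m)%N -> G n `<=` G m.
  elim: m => [|m ih]; first by rewrite leqn0 => /eqP ->.
  rewrite leq_eqVlt => /predU1P[->//|]; rewrite ltnS => /ih nm i /nm Gi.
  by left.
pose z n := (zG (n, G n)).1.
have zx : z @ \oo --> x.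
  apply/prod_cvgP => i A Ai.
  have [N NA] := (UP i).2 _ Ai.
  (* A coordinate that enters some [G m] is controlled from then on; any other coordinate is never
     changed. *)
  have [[m Gm]|nG] := pselect (exists m, G m i).
    exists (maxn m N) => // n; rewrite /= geq_max => /andP[mn Nn].
    apply: (NA _ Nn); have [_ _ + _] := zGP (n, G n) (fG n).
    by apply; exact: GS Gm.
  exists 0%N => // n _ /=; have [_ zi _ _] := zGP (n, G n) (fG n).
  rewrite /z zi; first exact: nbhs_singleton.
  by move=> Gi; apply: nG; exists n.+1; right.
have /cvgrPdist_lt/(_ (e / 2)) : f @ (z @ \oo) --> f x.
  apply: (@within_continuous_cvg _ _ ([set x] `|` range z)) => //.
  - exact/cf/convergent_sequence_compact.
  - by left.
  - by exists 0%N => // n _; right; exists n.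
rewrite divr_gt0// => /(_ isT)[N _ /(_ N (leqnn _))]/=.
by have [_ _ _] := zGP (N, G N) (fG N); rewrite leNgt => /negP.
Qed.

Lemma evenly_continuousP (Y : topologicalType) (K : set (Ck Y R)) :
  evenly_continuous K <-> forall y f, K f -> forall e : R, 0 < e ->
    exists N M, [/\ nbhs y N, nbhs f M & forall y' g, N y' -> M g -> K g ->
      `|ckfun f y - ckfun g y'| < e].
Proof.
split.
  move=> ecK y f Kf e e0.
  have [[N M] /= [Ny Mf NM]] :=
    (continuous_at_distP _ _).1 (ecK (y, exist _ f (mem_set Kf))) e e0.
  have [ O [oO Of OM]] : exists O : set (Ck Y R), [/\ open O, O f & val @^-1` O `<=` M].
    have : @nbhs _ (set_type K : topologicalType) (exist _ f (mem_set Kf)) M by exact: Mf.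
    by rewrite nbhsE => -[ B [[ O oO <-]] /= Of BM]; exists O.
  exists N, O; split => //; first exact: (@open_nbhs_nbhs (Ck Y R) f O (conj oO Of)).
  move=> y' g Ny' Og Kg; apply: (NM (y', exist _ g (mem_set Kg))).
  by split => //; exact: OM.
move=> H [y [f Kf]]; apply/cvgrPdist_lt => e e0.
have [N [M [Ny Mf NM]]] := H y f (set_mem Kf) e e0.
exists (N, val @^-1` M) => /=.
  split => //=.
  exact: (@initial_continuous (set_type K) (Ck Y R) val (exist _ f Kf) M Mf).
move=> [y' [g Kg]]/= [Ny' Mg]; apply: NM => //; exact: set_mem.
Qed.

Lemma kR_space_ascoli (Y : topologicalType) : kR_space R Y -> ascoli R Y.
Proof.
move=> kRY K cK; apply/evenly_continuousP => y0 f0 Kf0 e e0.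
(* Truncation at 1 makes the supremum over [K] finite and leaves small values unchanged. *)
pose S y := [set Num.min 1 `|ckfun f y0 - ckfun f y| | f in K].
have Sub y : has_sup (S y).
  split; first by exists (Num.min 1 `|ckfun f0 y0 - ckfun f0 y|); exists f0.
  by exists 1 => _ [f Kf <-]; rewrite ge_min lexx.
pose h y := sup (S y).
have hle y y' (r : R) : (forall f, K f -> `|ckfun f y - ckfun f y'| < r) -> h y <= h y' + r.
  move=> yy'; apply: ge_sup; first by have [] := Sub y.
  move=> _ [f Kf <-].
  have : Num.min 1 `|ckfun f y0 - ckfun f y'| <= h y'.
    by apply: sup_upper_bound => //; exists f.
  have := yy' f Kf; have := ler_distD (ckfun f y') (ckfun f y0) (ckfun f y).
  rewrite [`|ckfun f y' - _|]distrC.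
  have := normr_ge0 (ckfun f y - ckfun f y').
  move: `|_ - _| `|_ - _| `|_ - _| => a b c.
  move=> c0 bac cr; rewrite !minEle; case: (leP 1 a) => ?; case: (leP 1 b) => ?; lra.
(* On a compact [C] the members of [K] are equicontinuous, so [h] is continuous there, and the k_R
   property applies. *)
have ch : continuous h.
  apply: kRY => C cC; apply/subspace_continuousP => y Cy.
  apply/cvg_distP => r r0.
  have r20 : 0 < r / 2 by rewrite divr_gt0.
  have near_y : within C (nbhs y) [set y' | K `<=` [set f | `|ckfun f y - ckfun f y'| < r / 2]].
    exact: (compact_equicontinuous_within (@ball_embedding_id R) cK cC Cy r20).
  apply: filterS near_y => y' near_y.
  have h1 : h y <= h y' + r / 2 := hle y y' _ near_y.
  have h2 : h y' <= h y + r / 2 by apply: hle => f Kf; rewrite distrC; exact: near_y.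
  rewrite /= -/(h y) -/(h y') /from_subspace.
  by rewrite ltr_norml; apply/andP; split; lra.
have hy0 : h y0 = 0.
  rewrite /h (_ : S y0 = [set 0]) ?sup1//; apply/seteqP; split.
    by move=> _ [f Kf <-]; rewrite subrr normr0 /= minEle ler10.
  by move=> _ ->; exists f0 => //; rewrite subrr normr0 /= minEle ler10.
have e20 : 0 < e / 2 by rewrite divr_gt0.
have m0 : 0 < Num.min 1 (e / 2) by rewrite lt_min ltr01.
exists [set y | `|h y0 - h y| < Num.min 1 (e / 2)], [set g | `|ckfun f0 y0 - ckfun g y0| < e / 2].
split.
- exact: (continuous_at_distP _ _).1 (ch y0) _ m0.
- exact: (continuous_at_distP _ _).1 (@Ck_eval_continuous Y R y0 f0) _ e20.
move=> y g /= hy gy Kg; rewrite hy0 sub0r normrN in hy.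
(* The bound lies below 1 as well as below e/2, so the truncation is inactive and the estimate holds
   for the distance itself. *)
have : Num.min 1 `|ckfun g y0 - ckfun g y| < Num.min 1 (e / 2).
  apply: le_lt_trans hy; apply: le_trans (ler_norm _).
  by apply: sup_upper_bound => //; exists g.
rewrite lt_min !gt_min ltxx /= => /andP[g1 g2].
have {}g2 : `|ckfun g y0 - ckfun g y| < e / 2 by case/orP: g2 => // /(lt_trans g1).
by rewrite (splitr e) (le_lt_trans (ler_distD (ckfun g y0) _ _))// ltrD.
Qed.

(** Composition with [r] carries [K] to a compact set of functions on [B]; its even continuity at
    [i a] gives that of [K] at [a]. *)
Lemma retract_ascoli (A B : topologicalType) (i : A -> B) (r : B -> A) :
  continuous i -> continuous r -> cancel i r -> ascoli R B -> ascoli R A.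
Proof.
move=> ci cr ir aB K cK; apply/evenly_continuousP => a f Kf e e0.
have cfr (g : Ck A R) : continuous (ckfun g \o r).
  by move=> b; apply: continuous_comp; [exact: cr|exact: ckfun_continuous].
pose rs g := ck (cfr g) : Ck B R.
have crs : continuous rs.
  by apply: (@Ck_comp_continuous A B R R r id cr) => // y U.
have cK' : compact (rs @` K).
  by apply: continuous_compact => //; exact: continuous_subspaceT.
have /evenly_continuousP ec := aB _ cK'.
have [|N [M [Na Mf NM]]] := ec (i a) (rs f) _ e e0; first by exists f.
exists (i @^-1` N), (rs @^-1` M); split.
- exact: ci.
- exact: crs.
move=> a' g Na' Mg Kg.
have := NM (i a') (rs g) Na' Mg; rewrite !ckE /= !ir; apply.
by exists g.
Qed.

End compactly_generated.

(** * The Ascoli property implies local compactness *)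

Section moving_off.
Variables (R : realType) (X : topologicalType).

Definition nbhs_sequence (K : set X) (U : nat -> set X) :=
  [/\ forall n, open (U n) /\ K `<=` U n,
      forall m n, (m <= n)%N -> U n `<=` U m &
      forall O, open O -> K `<=` O -> exists n, U n `<=` O].

Lemma point_countable_type_nbhs_sequence (x : X) : point_countable_type X ->
  exists K U, [/\ compact K, K x & nbhs_sequence K U].
Proof.
move=> /(_ x)[K [cK Kx [U [UP Ub]]]].
pose V := fix V n := if n is n'.+1 then V n' `&` U n else U 0%N.
have VU n : V n `<=` U n by case: n => [//|n] y [].
exists K, V; split => //; split.
- elim=> [|n [oV KV]]; first exact: UP.
  have [oU KU] := UP n.+1; split; first exact: openI.
  by move=> y Ky; split; [exact: KV|exact: KU].
- move=> m n; elim: n => [|n ih]; first by rewrite leqn0 => /eqP ->.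
  by rewrite leq_eqVlt => /predU1P[->//|]; rewrite ltnS => /ih mn y [/mn].
- move=> O oO KO; have [n UO] := Ub O oO KO.
  by exists n; apply: subset_trans UO.
Qed.

Variables (K : set X) (U : nat -> set X).
Hypotheses (cK : compact K) (KU : nbhs_sequence K U).

(** Every open set around [K] contains some [U n], hence all but finitely many of the points. *)
Lemma nbhs_sequence_compact (y : nat -> X) :
  (forall n, U n (y n)) -> compact (K `|` range y).
Proof.
have [_ Ud Ub] := KU => Uy.
apply: (compact_of_compact_nbhs_complement cK); first exact: subsetUl.
move=> O oO KO; have [n UO] := Ub O oO KO.
exists (y @` `I_n); first exact/finite_compact/finite_image/finite_II.
split.
  move=> x [[Kx|[m _ <-]] nOx]; first by case: nOx; exact: KO.
  exists m => //=; rewrite ltnNge; apply/negP => nm; apply: nOx.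
  by apply: UO; apply: Ud nm _ _.
by move=> _ [m _ <-]; right; exists m.
Qed.

(** Otherwise there are points x_N of [U N] and f_N in [F] with f_N below [a] on [K] and above [b]
    at x_N. Together with [K] these points form a compact set, on which [F] is equicontinuous. The
    resulting neighbourhoods of the points of [K] cover some [U n], and f_n jumps too far between a
    point of [K] and x_n. *)
Lemma compact_oscillation (Y : topologicalType) (e : Y -> R) (F : set (Ck X Y)) (a b : R) :
  ball_embedding e -> compact F -> a < b ->
  exists N, forall n x f, (N <= n)%N -> U n x -> F f ->
    (forall z, K z -> e (ckfun f z) < a) -> e (ckfun f x) <= b.
Proof.
move=> ye cF ab; apply: contrapT => H.
have /choice[xf xfP] : forall N, exists xf : X * Ck X Y,
    [/\ U N xf.1, F xf.2, forall z, K z -> e (ckfun xf.2 z) < a & b < e (ckfun xf.2 xf.1)].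
  move=> N; apply: contrapT => nN; apply: H; exists N => n x f Nn Ux Ff fa.
  rewrite leNgt; apply/negP => fb; apply: nN; exists (x, f); split => //=.
  by have [_ Ud _] := KU; exact: Ud Nn _ Ux.
have cC : compact (K `|` range (fun n => (xf n).1)).
  by apply: nbhs_sequence_compact => n; have [] := xfP n.
set C := _ `|` _ in cC.
have ba : 0 < b - a by rewrite subr_gt0.
pose P p := [set x | C x -> F `<=` [set f | `|e (ckfun f p) - e (ckfun f x)| < b - a]].
have [_ _ Ub] := KU.
have [||n UO] := Ub (\bigcup_(p in K) (P p)°).
- by apply: bigcup_open => p _; exact: open_interior.
- move=> p Kp; exists p => //.
  have := compact_equicontinuous_within ye cF cC (or_introl Kp) ba.
  by rewrite /within.
have [Ux Ff fa fb] := xfP n.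
have [p Kp /interior_subset Px] := UO _ Ux.
have := Px (or_intror (imageT _ n)) _ Ff; have := fa p Kp.
move: fb => /= fb fa' /=; rewrite ltr_norml => /andP[? ?]; lra.
Qed.

End moving_off.

(** * Functions into the unit interval *)

Section unit_interval_valued.
Variables (R : realType).
Local Notation I := (unit_interval R).
Variable (X : topologicalType).
Implicit Types (f g : Ck X I).

Definition realv f (x : X) : R := val (ckfun f x).

Lemma realv_le1 f x : realv f x <= 1.
Proof. by have := set_valP (ckfun f x); rewrite /= in_itv /= => /andP[]. Qed.

Lemma unit_interval_Ck (f : X -> R) : continuous f ->
  (forall x, 0 <= f x <= 1) -> exists g, realv g =1 f.
Proof.
move=> cf f01.
have f01' x : f x \in `[0, 1]%classic by rewrite inE /= in_itv; exact: f01.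
pose g x : I := exist _ (f x) (f01' x).
have cg : continuous g.
  move=> x A /(@ball_embedding_val R _ (g x))[r r0 rA].
  have := (continuous_at_distP _ _).1 (cf x) r r0.
  by apply: filterS => y xy; exact: rA.
by exists (ck cg).
Qed.

Lemma realv_continuous x : continuous (fun f => realv f x).
Proof.
move=> f; apply: (@continuous_comp _ _ _ (fun f => ckfun f x) val).
  exact: Ck_eval_continuous.
exact: (ball_embedding_continuous (@ball_embedding_val R _)).
Qed.

Lemma Ck_unit_nbhsP f (A : set (Ck X I)) :
  nbhs f A <-> exists K, exists2 r : R, compact K /\ 0 < r &
    [set g | forall x, K x -> `|realv f x - realv g x| < r] `<=` A.
Proof. exact: (Ck_nbhs_ballP (@ball_embedding_val R _)). Qed.

Definition ksup (K : set X) f : R := sup (realv f @` K).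

Lemma has_sup_realv (K : set X) f : K !=set0 -> has_sup (realv f @` K).
Proof.
move=> [x Kx]; split; first by exists (realv f x); exists x.
by exists 1 => _ [y Ky <-]; exact: realv_le1.
Qed.

Lemma realv_le_ksup (K : set X) f x : K x -> realv f x <= ksup K f.
Proof.
move=> Kx; apply: sup_upper_bound; last by exists x.
by apply: has_sup_realv; exists x.
Qed.

(** The supremum over [K] is 1-Lipschitz for uniform distance on [K]. *)
Lemma ksup_continuous (K : set X) : compact K -> K !=set0 -> continuous (ksup K).
Proof.
move=> cK K0 f; apply/continuous_at_distP => e e0.
have e20 : 0 < e / 2 by rewrite divr_gt0.
apply/Ck_unit_nbhsP; exists K, (e / 2) => // g fg /=.
have le12 (f1 f2 : Ck X I) : (forall x, K x -> `|realv f1 x - realv f2 x| < e / 2) ->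
    ksup K f1 <= ksup K f2 + e / 2.
  move=> H; apply: ge_sup; first by have [] := has_sup_realv f1 K0.
  move=> _ [x Kx <-]; have := H x Kx; have := realv_le_ksup f2 Kx.
  by rewrite ltr_norml => ? /andP[? ?]; lra.
have h1 := le12 _ _ fg.
have h2 : ksup K g <= ksup K f + e / 2 by apply: le12 => x Kx; rewrite distrC; exact: fg.
by rewrite ltr_norml; apply/andP; split; lra.
Qed.

End unit_interval_valued.

(** A compact set sees only finitely many [F j], so they tend to 0 and form a compact set together
    with 0. Even continuity at [z] and 0 would then force [F j] below 1 at some [a j] near [z]. *)
Lemma not_ascoli_of_compact_finite (R : realType) (Y : topologicalType) (z : Y)
    (J : Type) (a : J -> Y) (F : J -> Ck Y R) :
  (forall K, compact K -> finite_set [set j | exists2 y, K y & ckfun (F j) y != 0]) ->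
  (forall N, nbhs z N -> infinite_set [set j | N (a j)]) ->
  (forall j, 1 <= ckfun (F j) (a j)) -> ~ ascoli R Y.
Proof.
move=> Ffin ainf F1 aY.
pose F0 : Ck Y R := (cst (0 : R) : continuousType Y R).
have F0nbhs (N : set (Ck Y R)) : nbhs F0 N -> finite_set [set j | ~ N (F j)].
  move=> /(Ck_nbhs_ballP (@ball_embedding_id R))[K [r [cK r0] KN]].
  apply: sub_finite_set (Ffin K cK) => j NFj; apply: contrapT => FK; apply: NFj.
  apply: KN => y Ky; have [->|Fy] := eqVneq (ckfun (F j) y) 0.
    by rewrite subr0 normr0.
  by case: FK; exists y.
have cC : compact ([set F0] `|` range F).
  apply: (compact_of_compact_nbhs_complement (@compact_set1 _ F0)).
    exact: subsetUl.
  move=> O oO FO; have := F0nbhs O (open_nbhs_nbhs (conj oO (FO _ erefl))).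
  move=> fE; exists (F @` [set j | ~ O (F j)]); first exact/finite_compact/finite_image.
  split; last by move=> _ [j _ <-]; right; exists j.
  by move=> _ [[->|[j _ <-]] nO]; [case: nO; exact: FO|exists j].
have /evenly_continuousP := aY _ cC.
move=> /(_ z F0 (or_introl erefl) 1 ltr01)[N [M [Nz MF NM]]].
have := ainf N Nz; apply; apply: sub_finite_set (F0nbhs M MF) => j Nj MFj.
have := NM (a j) (F j) Nj MFj (or_intror (imageT _ j)).
rewrite sub0r normrN => /(le_lt_trans (ler_norm _)).
by rewrite ltNge F1.
Qed.

Section ascoli_locally_compact.
Variables (R : realType) (X : topologicalType).
Hypotheses (hausX : hausdorff_space X) (paraX : paracompact X).
Local Notation I := (unit_interval R).

Lemma paracompact_bump (x : X) (W : set X) : open W -> W x ->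
  exists f : X -> R, [/\ continuous f, forall y, 0 <= f y <= 1, f x = 1 &
    forall y, ~ W y -> f y = 0].
Proof.
move=> oW Wx.
have crX : completely_regular_space X.
  exact: (@normal_completely_regular R X (paracompact_normal paraX hausX)
    (hausdorff_accessible hausX)).
have nWx : ~ (~` W) x by [].
have [f [cf f01 f0 f1]] :=
  (@uniform_separatorP X R _ _).1 (crX x (~` W) (open_closedC oW) nWx).
(* The separating function is 0 at [x] and 1 off [W], hence the reflection. *)
exists (fun y => 1 - f y); split.
- by move=> y; apply: cvgB; [exact: cvg_cst|exact: cf].
- move=> y; have := f01 (f y) (imageT f y); rewrite /= in_itv /= => /andP[? ?].
  by apply/andP; split; lra.
- by rewrite (f0 (f x)) ?subr0//; exists x.
- by move=> y nWy; rewrite (f1 (f y)) ?subrr//; exists y.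
Qed.

Lemma max0_affine_continuous (T : topologicalType) (f : T -> R) (c d : R) :
  continuous f -> continuous (fun t => Num.max 0 (c * f t + d)).
Proof.
move=> cf t; apply: (@continuous_max R T (cst 0) (fun t => c * f t + d)).
  exact: cvg_cst.
by apply: cvgD; [apply: cvgM; [exact: cvg_cst|exact: cf]|exact: cvg_cst].
Qed.

Lemma ascoli_locally_compact : point_countable_type X ->
  ascoli R (Ck X I) -> locally_compact [set: X].
Proof.
move=> pctX aX; apply: contrapT => nlc.
have [x0 nx0] : exists x0 : X, forall V, nbhs x0 V -> closed V -> ~ compact V.
  apply: contrapT => H; apply: nlc => x _; apply: contrapT => Hx.
  apply: H; exists x => V Vx clV cV; apply: Hx; exists V => //.
  by apply: filterS Vx => y Vy _.
have [K [U [cK Kx0 KU]]] := point_countable_type_nbhs_sequence x0 pctX.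
have [UP Ud Ub] := KU.
(* [x0] has no compact closed neighbourhood, so the one found inside [U n] carries a locally finite
   sequence away from [K]. *)
have /choice[Wx WxP] : forall n, exists Wx : (nat -> set X) * (nat -> X),
    (forall k, [/\ open (Wx.1 k), Wx.1 k (Wx.2 k), U n (Wx.2 k) & Wx.1 k `&` K = set0]) /\
    (forall C, compact C -> finite_set [set k | Wx.1 k `&` C !=set0]).
  move=> n; have [oU KUn] := UP n.
  have [V [Vx clV VU]] :=
    paracompact_closed_nbhs paraX hausX (open_nbhs_nbhs (conj oU (KUn _ Kx0))).
  have [W [x [WxP Wfin]]] :=
    noncompact_discrete_sequence paraX clV (nx0 V Vx clV) cK.
  exists (W, x); split => // k; have [oW Wxk Vxk WK] := WxP k.
  by split => //; exact: VU.
pose W n k := (Wx n).1 k; pose x n k := (Wx n).2 k.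
have oW n k : open (W n k) by have [/(_ k)[]] := WxP n.
have Wxnk n k : W n k (x n k) by have [/(_ k)[]] := WxP n.
have Ux n k : U n (x n k) by have [/(_ k)[]] := WxP n.
have WK n k y : K y -> ~ W n k y.
  move=> Ky Wy; have [/(_ k)[_ _ _ WK] _] := WxP n.
  by have : ((Wx n).1 k `&` K) y by []; rewrite WK.
have Wfin n C : compact C -> finite_set [set k | W n k `&` C !=set0].
  by have [_ ] := WxP n; exact.
have /choice[phi phiP] : forall nk : nat * nat, exists f : X -> R,
    [/\ continuous f, forall y, 0 <= f y <= 1, f (x nk.1 nk.2) = 1 &
      forall y, ~ W nk.1 nk.2 y -> f y = 0].
  by move=> [n k]; exact: paracompact_bump.
have n1 n : 0 < n.+1%:R^-1 :> R by rewrite invr_gt0.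
have n1le n : n.+1%:R^-1 <= 1 :> R by rewrite invf_le1 // ler1n.
have /choice[a aP] : forall nk : nat * nat, exists g : Ck X I,
    forall y, realv g y = Num.max (phi nk y) (phi (nk.2, 0%N) y * nk.1.+1%:R^-1).
  move=> nk; have [cphi phi01 _ _] := phiP nk.
  have [cphi' phi01' _ _] := phiP (nk.2, 0%N).
  apply: unit_interval_Ck.
    move=> y; apply: (@continuous_max R X (phi nk)
      (fun y => phi (nk.2, 0%N) y * nk.1.+1%:R^-1)); first exact: cphi.
    by apply: cvgM; [exact: cphi'|exact: cvg_cst].
  move=> y; have /andP[p0 p1] := phi01 y; have /andP[q0 q1] := phi01' y.
  rewrite le_max p0 /= ge_max p1 /=.
  by rewrite (le_trans (ler_wpM2r (ltW (n1 _)) q1))// mul1r.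
(* [a (n, k)] vanishes on [K], is at least 1 at [x n k] and at least 1/(n+1) = 3 / c n at [x k 0];
   the thresholds 1 / c n, 2/3 and 2 / c n leave room on each side. *)
pose c n : R := 3 * n.+1%:R.
have c0 n : 0 < c n by rewrite mulr_gt0.
(* F (n, k) is nonzero only at those g with g < 1/(3(n+1)) on K,
   g(x_{n,k}) > 2/3 and g(x_{k,0}) > 2/(3(n+1)). *)
pose P1 nk (g : Ck X I) : R := Num.max 0 (3 * realv g (x nk.1 nk.2) + - 2).
pose P2 nk (g : Ck X I) : R := Num.max 0 (c nk.1 * realv g (x nk.2 0%N) + - 2).
pose P3 (nk : nat * nat) (g : Ck X I) : R := Num.max 0 (- c nk.1 * ksup K g + 1).
have cP1 nk : continuous (P1 nk).
  exact: (@max0_affine_continuous (Ck X I) _ _ _ (@realv_continuous R X _)).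
have cP2 nk : continuous (P2 nk).
  exact: (@max0_affine_continuous (Ck X I) _ _ _ (@realv_continuous R X _)).
have cP3 nk : continuous (P3 nk).
  apply: (@max0_affine_continuous (Ck X I)).
  by apply: ksup_continuous => //; exists x0.
have cF nk : continuous (fun g => P1 nk g * P2 nk g * P3 nk g).
  move=> g; apply: (@cvgM _ (Ck X I) (nbhs g)); last exact: cP3.
  by apply: (@cvgM _ (Ck X I) (nbhs g)); [exact: cP1|exact: cP2].
pose F nk : Ck (Ck X I) R := ck (cF nk).
have F_neq0 nk g : ckfun (F nk) g != 0 ->
    [/\ forall z, K z -> realv g z < (c nk.1)^-1, 2 / 3 < realv g (x nk.1 nk.2) &
      2 / c nk.1 < realv g (x nk.2 0%N)].
  rewrite ckE !mulf_eq0 !negb_or => /andP[/andP[H1 H2] H3].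
  have pos (t : R) : Num.max 0 t != 0 -> 0 < t.
    by rewrite maxEle; case: (leP 0 t) => [t0 t1|]; [rewrite lt_neqAle eq_sym t1|rewrite eqxx].
  split.
  - move=> z Kz; rewrite (le_lt_trans (realv_le_ksup g Kz))// -div1r ltr_pdivlMr//.
    by have := pos _ H3; rewrite mulrC; lra.
  - by have := pos _ H1; lra.
  - by rewrite ltr_pdivrMr//; have := pos _ H2; rewrite mulrC; lra.
have [z0 z0E] : exists g : Ck X I, realv g =1 (fun _ => 0).
  by apply: unit_interval_Ck => [y|y]; [exact: cvg_cst|rewrite lexx ler01].
apply: (@not_ascoli_of_compact_finite R (Ck X I) z0 (nat * nat)%type a F _ _ _ aX).
- move=> KK cKK.
  have vE := @ball_embedding_val R `[0, 1]%classic.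
  (* Members of [KK] below 1/3 on [K] are at most 2/3 on [U n] for large [n]; the condition at
     [x n k] therefore bounds [n]. *)
  have [|N HN] := compact_oscillation cK KU (a := 1 / 3) (b := 2 / 3) vE cKK.
    by rewrite ltr_pM2r// ltr1n.
  (* For fixed [n] the condition at [x k 0], a point of [U k], bounds [k] in the same way. *)
  have /choice[M HM] : forall n, exists M, forall k, (M <= k)%N ->
      forall g, KK g -> ckfun (F (n, k)) g = 0.
    move=> n; have [|M HM] := compact_oscillation cK KU
      (a := (c n)^-1) (b := 2 / c n) vE cKK.
      by rewrite -[ltLHS]mul1r ltr_pM2r ?invr_gt0// ltr1n.
    exists M => k Mk g KKg; apply/eqP; apply: contrapT => /negP/F_neq0[/= gK _].
    by rewrite ltNge => /negP; apply; apply: (HM k _ g Mk (Ux k 0%N)).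
  apply: (@sub_finite_set _ _ (\bigcup_(n in `I_N) ((pair n) @` `I_(M n)))).
    move=> [n k] [g KKg Fg].
    have nN : (n < N)%N.
      rewrite ltnNge; apply/negP => Nn; have [/= gK g23 _] := F_neq0 _ _ Fg.
      move: g23; rewrite ltNge => /negP; apply; apply: (HN n _ g Nn (Ux n k)) => //.
      move=> z Kz; apply: lt_le_trans (gK z Kz) _.
      rewrite /c div1r lef_pV2 ?posrE ?mulr_gt0//.
      by rewrite ler_peMr// ler1n.
    exists n => //; exists k => //=; rewrite ltnNge; apply/negP => Mk.
    by rewrite (HM n k Mk g KKg) eqxx in Fg.
  apply: bigcup_finite; first exact: finite_II.
  by move=> n _; apply: finite_image; exact: finite_II.
- move=> A /Ck_unit_nbhsP[C [r [cC r0] CA]].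
  have [n nr] : exists n, n.+1%:R^-1 < r.
    have := near_infty_natSinv_lt (PosNum r0) => -[n _ /(_ n (leqnn _))].
    by exists n.
  have fE := Wfin n C cC.
  (* For this [n], [a (n, k)] is below [r] on [C] whenever [W n k] misses [C], that is, for all but
     finitely many [k]. *)
  apply: (@sub_infinite_set _ (pair n @` ~` [set k | W n k `&` C !=set0])).
    move=> _ [k nWC <-]; apply: CA => y Cy.
    rewrite z0E sub0r normrN aP /=.
    have [_ _ _ ->] := phiP (n, k); last first.
      by move=> /= Wy; apply: nWC; exists y.
    have [_ /(_ y)/andP[q0 q1] _ _] := phiP (k, 0%N).
    have q2 : 0 <= phi (k, 0%N) y / n.+1%:R by rewrite divr_ge0.
    rewrite max_r// ger0_norm// (le_lt_trans _ nr)//.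
    by rewrite -[leRHS]mul1r ler_wpM2r// ltW.
  move=> fP; apply: infinite_nat.
  have fk : finite_set (~` [set k | W n k `&` C !=set0]).
    apply: (@sub_finite_set _ _ (snd @` (pair n @` ~` [set k | W n k `&` C !=set0]))).
      by move=> k nk; exists (n, k) => //; exists k.
    exact: finite_image.
  by rewrite -(setvU [set k | W n k `&` C !=set0]) finite_setU.
(* At [a (n, k)] the first two factors are at least 3 - 2 = 1, and the third is 1 because the
   function vanishes on [K]. *)
- move=> [n k]; rewrite ckE.
  have sa : ksup K (a (n, k)) = 0.
    rewrite /ksup (_ : _ @` K = [set 0]) ?sup1//; apply/seteqP; split.
      move=> _ [y Ky <-]; rewrite aP /=.
      have [_ _ _ ->] := phiP (n, k); last exact: WK.
      by have [_ _ _ ->] := phiP (k, 0%N); [rewrite mul0r maxxx|exact: WK].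
    move=> _ ->; exists x0 => //; rewrite aP /=.
    have [_ _ _ ->] := phiP (n, k); last exact: WK.
    by have [_ _ _ ->] := phiP (k, 0%N); [rewrite mul0r maxxx|exact: WK].
  have a1 : 1 <= realv (a (n, k)) (x n k).
    by rewrite aP /= le_max; have [_ _ -> _] := phiP (n, k); rewrite lexx.
  have a2 : n.+1%:R^-1 <= realv (a (n, k)) (x k 0%N).
    rewrite aP /= le_max; have [_ _ -> _] := phiP (k, 0%N).
    by rewrite mul1r lexx orbT.
  have p1 : 1 <= P1 (n, k) (a (n, k)) by rewrite /P1 le_max /=; apply/orP; right; lra.
  have p2 : 1 <= P2 (n, k) (a (n, k)).
    rewrite /P2 le_max /=; apply/orP; right.
    have : c n * n.+1%:R^-1 <= c n * realv (a (n, k)) (x k 0%N) by rewrite ler_pM2l.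
    by rewrite /c mulfK// -/(c n); lra.
  have p3 : P3 (n, k) (a (n, k)) = 1.
    by rewrite /P3 sa mulr0 add0r max_r.
  by rewrite p3 mulr1 -[leLHS]mul1r ler_pM.
Qed.
End ascoli_locally_compact.

(** * Decomposition of locally compact paracompact spaces *)

Section subtypes.
Variables (X : topologicalType) (A : set X).

Lemma set_type_nbhsP (z : set_type A) (B : set (set_type A)) :
  nbhs z B <-> exists2 N, nbhs (val z) N & val @^-1` N `<=` B.
Proof.
split.
  move=> zB; have [ C [[ O oO <-] Oz] CB] : exists2 C, open_nbhs z C & C `<=` B.
    by move: zB; rewrite nbhsE.
  by exists O => //; exact: open_nbhs_nbhs.
move=> [N Nz NB]; apply: (filterS NB).
exact: (@initial_continuous (set_type A) X val z N Nz).
Qed.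

Lemma val_continuous : continuous (val : set_type A -> X).
Proof. exact: initial_continuous. Qed.

Lemma set_type_compact (K : set X) : compact K -> K `<=` A ->
  compact (val @^-1` K : set (set_type A)).
Proof.
move=> cK KA F PF FK.
have [x [Kx clx]] := cK (val @ F) _ FK.
exists (exist _ x (mem_set (KA x Kx))); split => // S B FS /set_type_nbhsP[N Nx NB].
have FS' : F (val @^-1` (val @` S)) by apply: filterS FS => z Sz; exists z.
by have [_ [[z Sz <-] Nz]] := clx _ _ FS' Nx; exists z; split => //; exact: NB.
Qed.

Lemma set_type_locally_compact : closed A -> locally_compact [set: X] ->
  locally_compact [set: set_type A].
Proof.
move=> clA lcX z _; have [U Uz [cU clU]] := lcX (val z) I.
exists (val @^-1` (U `&` A)).
  rewrite /within /=; apply/set_type_nbhsP; exists U.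
    by move: Uz; rewrite /within /=; apply: filterS => x; apply.
  by move=> y Uy _; split => //; exact: set_valP.
split; first by apply: set_type_compact => //; exact: compact_closedI.
apply: preimage_closed; last exact: closedI.
by move=> y _; exact: val_continuous.
Qed.

End subtypes.

Lemma sigma_compact_lindelof (X : topologicalType) (K : nat -> set X) :
  (forall n, compact (K n)) -> \bigcup_n K n = [set: X] -> lindelof X.
Proof.
move=> cK KT C [Cop CT].
have /choice[E EP] : forall n, exists E : set (set X),
    [/\ finite_set E, E `<=` C & K n `<=` \bigcup_(V in E) V].
  move=> n; have [|E [fE EC] KE] := @compact_finite_cover X _ C id (K n) (cK n).
    move=> x _; have : [set: X] x by [].
    rewrite -CT => -[V CV Vx]; exists V => //.
    by apply: open_nbhs_nbhs; split => //; exact: Cop.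
  by exists E.
exists (\bigcup_n E n); split.
- by move=> V [n _ EV]; have [_ + _] := EP n; exact.
- by apply: bigcup_countable => // n _; apply: finite_set_countable; have [] := EP n.
- split; first by move=> V [n _ EV]; apply: Cop; have [_ + _] := EP n; exact.
  rewrite -subTset => x _; have : [set: X] x by [].
  rewrite -KT => -[n _ Kx]; have [_ _ /(_ _ Kx)[V EV Vx]] := EP n.
  by exists V => //; exists n.
Qed.

Section decomposition.
Variables (X : topologicalType) (D : set (set X)).
Hypotheses (Dop : D `<=` open) (DT : \bigcup_(V in D) V = [set: X])
  (lfD : locally_finite D) (cD : forall V, D V -> compact (closure V)).

(** These are the unions of classes for the relation of being joined by a finite chain of
    successively intersecting members of [D]. *)
Definition saturated (A : set X) := forall V, D V -> V `&` A !=set0 -> V `<=` A.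

Lemma saturatedC (A : set X) : saturated A -> saturated (~` A).
Proof.
move=> sA V DV [x [Vx nAx]] y Vy Ay; apply: nAx; apply: (sA V) => //.
by exists y.
Qed.

Lemma saturated_open (A : set X) : saturated A -> open A.
Proof.
move=> sA; rewrite openE => x Ax; have : [set: X] x by [].
rewrite -DT => -[V DV Vx]; have : nbhs x V.
  by apply: open_nbhs_nbhs; split => //; exact: Dop.
by apply: filterS; apply: sA => //; exists x.
Qed.

Lemma saturated_closed (A : set X) : saturated A -> closed A.
Proof. by move=> /saturatedC/saturated_open/open_closedC; rewrite setCK. Qed.

(** The points joined to [x] by such chains. Defining the class as an intersection makes its
    saturation and the disjointness of different classes formal. *)
Definition component_of (x : X) : set X :=
  [set y | forall A, saturated A -> A x -> A y].

Lemma component_saturated x : saturated (component_of x).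
Proof.
move=> V DV [y [Vy xy]] z Vz A sA Ax; apply: (sA V) => //.
by exists y; split => //; exact: xy.
Qed.

Lemma component_self x : component_of x x. Proof. by move=> A. Qed.

Lemma component_eq x y : component_of x y -> component_of x = component_of y.
Proof.
move=> xy; apply/seteqP; split => z; last first.
  by move=> yz A sA Ax; apply: yz => //; exact: xy.
move=> xz A sA Ay; apply: xz => //; apply: contrapT => nAx.
exact: (xy (~` A) (saturatedC sA) nAx).
Qed.

Lemma component_sigma_compact x : exists K : nat -> set X,
  (forall n, compact (K n)) /\ component_of x `<=` \bigcup_n K n.
Proof.
(* [K n] contains what chains of length [n] reach. Local finiteness keeps each stage a finite union
   of compact closures, and the union of all stages is saturated. *)
pose K := fix K n := if n is n'.+1 then
  \bigcup_(V in [set V | D V /\ V `&` K n' !=set0]) closure V else [set x].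
have cK n : compact (K n).
  elim: n => [|n ih]; first exact: compact_set1.
  rewrite /K -/K.
  have := compact_locally_finite lfD ih; set E := [set V | _] => fE.
  by apply: finite_bigcup_compact => // V [DV _]; exact: cD.
exists K; split => // y; apply; last by exists 0%N.
move=> V DV [z [Vz [n _ Knz]]] t Vt; exists n.+1 => //=; exists V.
  by split => //; exists z.
exact: subset_closure.
Qed.

Lemma component_lindelof x : lindelof (set_type (component_of x)).
Proof.
have [K [cK KC]] := component_sigma_compact x.
apply: (@sigma_compact_lindelof (set_type (component_of x))
  (fun n => val @^-1` (K n `&` component_of x))).
  move=> n; apply: set_type_compact => //.
  by apply: compact_closedI => //; exact: saturated_closed (@component_saturated x).
rewrite -subTset => z _; have /KC[n _ Kn] := set_valP z.
by exists n => //; exact: (conj Kn (set_valP z)).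
Qed.

Lemma sum_of_components : exists (I : choiceType) (S : I -> set X),
  (forall i, exists x, S i = component_of x) /\
  homeomorphic X {i & set_type (S i)}.
Proof.
pose J : set (set X) := range component_of.
exists (set_type J), val; split.
  by move=> i; have [x _ <-] := set_valP i; exists x.
have Jc x : component_of x \in J by rewrite inE; exists x.
pose c x : set_type J := exist _ (component_of x) (Jc x).
have cx x : x \in val (c x) by rewrite inE; exact: component_self.
pose f x : {i : set_type J & set_type (val i)} := existT _ (c x) (exist _ x (cx x)).
(* The index of [val z] is [i] because components sharing a point coincide; the rewriting transports
   [z] along this equality. *)
have fE (i : set_type J) (z : set_type (val i)) : f (val z) = existT _ i z.
  have ci : c (val z) = i.
    apply: val_inj; rewrite /=; have [w _ wi] := set_valP i.
    have wz : component_of w (val z) by rewrite wi; exact: set_valP.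
    by rewrite -(component_eq wz).
  rewrite /f; move: (cx (val z)); rewrite ci => zi.
  by congr existT; exact: val_inj.
exists f, (fun p : {i : set_type J & set_type (val i)} => val (projT2 p)); split.
- by [].
- by move=> [i z] /=; exact: fE.
(* Near [x] the map stays in one summand, since the component of [x] is open. *)
- move=> x B; rewrite /nbhs /= => /set_type_nbhsP[N Nx NB].
  have : nbhs x (N `&` component_of x).
    apply: filterI => //; apply: open_nbhs_nbhs; split.
      exact: saturated_open (@component_saturated x).
    exact: component_self.
  apply: filterS => y [Ny xy].
  have yc : y \in val (c x) by rewrite inE.
  have := NB (exist _ y yc) Ny.
  by rewrite /= -(fE (c x) (exist _ y yc)).
- by move=> [i z] N Nz; exact: (@val_continuous X (val i) z N Nz).
Qed.

End decomposition.

(** A locally finite refinement of the open sets lying in closed compact sets has members with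
    compact closure; its chain components are the summands. *)
Lemma locally_compact_sum (X : topologicalType) : hausdorff_space X ->
  paracompact X -> locally_compact [set: X] -> sum_of_lindelof_locally_compact X.
Proof.
move=> hausX paraX lcX.
have [|D [[Dop DT] DC lfD]] :=
    paraX [set U | open U /\ exists2 C, compact C /\ closed C & U `<=` C].
  split; first by move=> U [].
  rewrite -subTset => x _; have [U Ux [cU clU]] := lcX x I.
  have {}Ux : nbhs x U by move: Ux; rewrite /within /=; apply: filterS => y; apply.
  exists U° => //; split; first exact: open_interior.
  by exists U => //; exact: interior_subset.
have cD V : D V -> compact (closure V).
  move=> /DC[U [_ [C [cC clC] UC]] VU].
  apply: (subclosed_compact (@closed_closure _ V) cC).
  have /closure_id -> := clC.
  by apply: closureS; exact: subset_trans UC.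
have [I [S [SC XS]]] := sum_of_components Dop DT.
exists I, (fun i => set_type (S i)); split => // i.
have [x ->] := SC i; split; first exact: component_lindelof.
apply: set_type_locally_compact => //.
exact: (saturated_closed Dop DT (@component_saturated _ D x)).
Qed.

(** * Function spaces as products of completely metrizable spaces *)

Lemma homeomorphic_trans (X Y Z : topologicalType) :
  homeomorphic X Y -> homeomorphic Y Z -> homeomorphic X Z.
Proof.
move=> [f [g [fK gK cf cg]]] [h [k [hK kK ch ck]]].
exists (h \o f), (g \o k); split.
- exact: can_comp.
- exact: can_comp.
- by move=> x; apply: continuous_comp; [exact: cf|exact: ch].
- by move=> x; apply: continuous_comp; [exact: ck|exact: cg].
Qed.

Lemma Ck_homeomorphic (X X' Y : topologicalType) :
  homeomorphic X X' -> homeomorphic (Ck X Y) (Ck X' Y).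
Proof.
move=> [u [v [uK vK cu cv]]].
have cfv (f : Ck X Y) : continuous (ckfun f \o v).
  by move=> x; apply: continuous_comp; [exact: cv|exact: ckfun_continuous].
have cfu (f : Ck X' Y) : continuous (ckfun f \o u).
  by move=> x; apply: continuous_comp; [exact: cu|exact: ckfun_continuous].
exists (fun f => ck (cfv f)), (fun f => ck (cfu f)); split.
- by move=> f; apply: ckP => x; exact: congr1 (uK x).
- by move=> f; apply: ckP => x; exact: congr1 (vK x).
- by apply: (@Ck_comp_continuous X X' Y Y v id cv) => // y A.
- by apply: (@Ck_comp_continuous X' X Y Y u id cu) => // y A.
Qed.

(** A compact subset of the sum meets finitely many summands, each in a compact trace, so a subbasic
    neighbourhood of a function constrains only finitely many of its restrictions. *)
Lemma Ck_sigT (I : choiceType) (Z : I -> topologicalType) (Y : topologicalType) :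
  homeomorphic (Ck {i & Z i} Y) (prod_topology (fun i => Ck (Z i) Y)).
Proof.
have cres (f : Ck {i & Z i} Y) i : continuous (ckfun f \o existT Z i).
  move=> z; apply: continuous_comp; first exact: existT_continuous.
  exact: ckfun_continuous.
have cglue (g : forall i, Ck (Z i) Y) :
    continuous (fun p : {i & Z i} => ckfun (g (projT1 p)) (projT2 p)).
  by move=> [i z] A; exact: (@ckfun_continuous _ _ (g i) z).
exists (fun f i => ck (cres f i)), (fun g => ck (cglue g)); split.
- by move=> f; apply: ckP => -[i z].
- by move=> g; apply: functional_extensionality_dep => i; apply: ckP => z.
- move=> f; apply: (@prod_cvgP _ _ _ (fmap_filter _ (nbhs_filter f)) _).2 => i.
  have := @Ck_comp_continuous _ _ Y Y (existT Z i) id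
    (@existT_continuous _ _ i) (fun y => cvg_id) (fun f => ck (cres f i)).
  by apply => //.
move=> g; apply/Ck_continuous_atP => K O cK oO gKO.
pose E := \bigcup_(p in K) [set projT1 p].
have fE : finite_set E.
  apply: compact_finite_relation => // -[i z] Kz; exists [set i]; first exact: finite_set1.
  by apply: (@nearW _ (nbhs z)) => z' j ->.
have cKi i : compact (existT Z i @^-1` K).
  move=> F PF FK; have [[j z] [Kz clz]] := cK (existT Z i @ F) _ FK.
  (* Summand [j] is a neighbourhood of the cluster point while the filter lives on summand [i]. *)
  have ij : i = j.
    have nj : nbhs (existT Z j z) [set p | projT1 p = j].
      by apply: (@filterS (Z j) (nbhs z) _ setT) => //; exact: filterT.
    have Fi : (existT Z i @ F) [set p | projT1 p = i].
      by apply: (@filterS (Z i) F _ setT) => //; exact: filterT.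
    by have [p [/= -> ->]] := clz _ _ Fi nj.
  move: ij z Kz clz => <- z Kz clz.
  exists z; split => // A B FA nB.
  have FA' : (existT Z i @ F) (existT Z i @` A).
    by apply: (@filterS (Z i) F _ A (existT Z i @^-1` (existT Z i @` A)) _ FA) => y Ay; exists y.
  have [_ [[a Aa <-] [b Bb ab]]] := clz _ _ FA' (@existT_nbhs I Z i z B nB).
  exists a; split => //.
  by rewrite -(existT_inj2 ab).
pose P i := [set h : Ck (Z i) Y | ckfun h @` (existT Z i @^-1` K) `<=` O].
have : nbhs (g : prod_topology (fun i => Ck (Z i) Y))
    [set h | forall i, E i -> P i (h i)].
  apply: (@filter_finite_forall _ I (nbhs _) (nbhs_filter _) E
    (fun i (h : prod_topology (fun i => Ck (Z i) Y)) => P i (h i)) fE) => i Ei.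
  apply: (@prod_proj_continuous I (fun i => Ck (Z i) Y) i g).
  apply: Ck_nbhs => // _ [z Kz <-]; apply: gKO; exists (existT Z i z) => //.
apply: (@filterS _ _ (@nbhs_filter (prod_topology (fun i => Ck (Z i) Y)) g)).
move=> h hP _ [[i z] Kz <-].
apply: (hP i); last by exists z.
by exists (existT Z i z).
Qed.

(** * Complete metrizability of function spaces *)

Section metrizability.
Variable R : realType.

(** [M] has the carrier of [T] and the topology of [d]; by [dnbhs] the identity is a
    homeomorphism. *)
Lemma completely_metrizable_of_dist (T : topologicalType) (d : T -> T -> R) :
  (forall x, d x x = 0) -> (forall x y, d x y = 0 -> x = y) ->
  (forall x y, d x y = d y x) -> (forall y x z, d x z <= d x y + d y z) ->
  (forall x A, nbhs x A <-> exists2 r : R, 0 < r & [set y | d x y < r] `<=` A) ->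
  (forall F : set_system T, ProperFilter F ->
    (forall r : R, 0 < r -> exists x, F [set y | d x y < r]) ->
    exists l : T, F --> l) ->
  completely_metrizable R T.
Proof.
move=> dxx dpos dsym dtri dnbhs dcomplete.
pose M : metricType R :=
  HB.pack (T : Type) (Choice.class (T : choiceType)) (@isMetric.Build R T d dxx dpos dsym dtri).
have MP (x : M) A : nbhs x A <-> exists2 r : R, 0 < r & [set y | d x y < r] `<=` A.
  by split => [/nbhs_ballP|H]; [|apply/nbhs_ballP].
exists M; split.
  move=> F PF /cauchyP cF; have [|l Fl] := dcomplete F PF; first exact: cF.
  by exists l => A /MP/dnbhs; exact: Fl.
exists id, id; split => //.
  by move=> x A /MP/dnbhs.
by move=> x A /dnbhs/MP.
Qed.

Lemma completely_metrizable_first_countable (T : topologicalType) :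
  completely_metrizable R T -> first_countable T.
Proof.
move=> [M [_ [f [g [fK gK cf cg]]]]] x.
exists (fun n => f @^-1` ball (f x) n.+1%:R^-1); split.
  by move=> n; apply: cf; apply: nbhsx_ballx; rewrite invr_gt0.
move=> A xA; have : nbhs (f x) (g @^-1` A) by apply: cg; rewrite fK.
move=> /nbhs_ballP[r r0 rA].
have [N _ Nr] := near_infty_natSinv_lt (PosNum r0).
exists N => n Nn y xy; rewrite -(fK y); apply: rA.
by apply: le_ball xy; apply: ltW; exact: Nr.
Qed.

Variables (Z Y : topologicalType) (e : Y -> R) (w : Z -> R).
Hypotheses (ye : ball_embedding e) (einj : injective e) (ecl : closed (range e))
  (lcZ : locally_compact [set: Z]) (w0 : forall z, 0 < w z) (w1 : forall z, w z <= 1)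
  (w_compact : forall C, compact C -> exists2 r : R, 0 < r & forall z, C z -> r <= w z)
  (compact_w : forall r : R, 0 < r -> exists2 C, compact C & forall z, r <= w z -> C z).
Implicit Types f g h : Ck Z Y.

(** The sets where [w] is at least [r] play the role of a compact exhaustion: distance below [r]
    forces differences below [r] there, and where [w] is smaller the truncation absorbs any
    difference. The added 0 keeps the supremum meaningful when [Z] is empty. *)
Definition weighted_dist f g : R :=
  sup ([set 0] `|` range (fun z => Num.min (w z) `|e (ckfun f z) - e (ckfun g z)|)).
Local Notation d := weighted_dist.

Let has_sup_d f g : has_sup ([set 0] `|`
  range (fun z => Num.min (w z) `|e (ckfun f z) - e (ckfun g z)|)).
Proof.
split; first by exists 0; left.
by exists 1 => _ [->|[z _ <-]]; rewrite ?ler01// ge_min w1.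
Qed.

Let d_ge0 f g : 0 <= d f g.
Proof. by apply: sup_upper_bound => //; left. Qed.

Let le_d f g z : Num.min (w z) `|e (ckfun f z) - e (ckfun g z)| <= d f g.
Proof. by apply: sup_upper_bound => //; right; exists z. Qed.

Let d_le f g (r : R) : 0 <= r ->
  (forall z, Num.min (w z) `|e (ckfun f z) - e (ckfun g z)| <= r) -> d f g <= r.
Proof.
move=> r0 H; apply: ge_sup; first by have [] := has_sup_d f g.
by move=> _ [->//|[z _ <-]].
Qed.

Let d_lt f g z (r : R) : d f g < r -> r <= w z ->
  `|e (ckfun f z) - e (ckfun g z)| < r.
Proof.
move=> dr rw; have := le_lt_trans (le_d f g z) dr.
by rewrite gt_min => /orP[/(le_lt_trans rw)|//]; rewrite ltxx.
Qed.

Let d_triangle f g h : d f h <= d f g + d g h.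
Proof.
apply: d_le => [|z]; first exact: addr_ge0.
apply: le_trans (lerD (le_d f g z) (le_d g h z)).
have := ler_distD (e (ckfun g z)) (e (ckfun f z)) (e (ckfun h z)).
have := w0 z; have := normr_ge0 (e (ckfun f z) - e (ckfun g z)).
have := normr_ge0 (e (ckfun g z) - e (ckfun h z)).
move: `|_ - _| `|_ - _| `|_ - _| => b a c b0 a0 wz cab.
rewrite !minEle; case: (leP (w z) a) => ?; case: (leP (w z) b) => ?;
  case: (leP (w z) c) => ?; lra.
Qed.

Let d_nbhs f A : nbhs f A <-> exists2 r : R, 0 < r & [set g | d f g < r] `<=` A.
Proof.
split.
  move=> /(Ck_nbhs_ballP ye)[K [r [cK r0] KA]].
  have [s s0 sw] := w_compact cK.
  exists (Num.min r s); first by rewrite lt_min r0 s0.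
  move=> g fg; apply: KA => z Kz.
  have := d_lt fg (z := z); rewrite ge_min sw ?orbT// lt_min => /(_ isT).
  by case/andP.
move=> [r r0 rA].
have r20 : 0 < r / 2 by rewrite divr_gt0.
have [C cC Cw] := compact_w r20.
apply/(Ck_nbhs_ballP ye); exists C, (r / 2) => // g fg; apply: rA => /=.
apply: (@le_lt_trans _ _ (r / 2)); last by lra.
apply: d_le => [|z]; first exact: ltW.
rewrite ge_min; have [rw|wr] := leP (r / 2) (w z); last by rewrite ltW.
by rewrite (ltW (fg z _)) ?orbT//; exact: Cw.
Qed.

Let d_complete (F : set_system (Ck Z Y)) : ProperFilter F ->
  (forall r : R, 0 < r -> exists f, F [set g | d f g < r]) -> exists l : Ck Z Y, F --> l.
Proof.
move=> PF cF.
have cvgF z : exists y : Y, (fun g => e (ckfun g z)) @ F --> e y.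
  have : cauchy ((fun g => e (ckfun g z)) @ F).
    apply: cauchy_exP => r r0.
    (* A radius of at most [w z] keeps the truncation at [z] inactive. *)
    have [|f Ff] := cF (Num.min r (w z)); first by rewrite lt_min r0 w0.
    have Fz : F [set g | `|e (ckfun f z) - e (ckfun g z)| < r].
      apply: filterS Ff => g /d_lt-/(_ z).
      by rewrite ge_min lexx orbT lt_min => /(_ isT)/andP[].
    by exists (e (ckfun f z)); exact: Fz.
  move=> /cauchy_cvg/cvg_ex[/= L FL].
  (* Closedness of the range brings the limit back into [Y]. *)
  have [y _ yL] : range e L.
    apply: (@closed_cvg _ _ F _ (fun g => e (ckfun g z)) (range e) ecl _ L FL).
    by apply: nearW => g; exists (ckfun g z).
  by exists y; rewrite yL.
have [l lP] := choice cvgF.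
(* Letting [g] run along [F] turns the Cauchy bound into a uniform bound against the pointwise
   limit. *)
have approx (r : R) : 0 < r -> exists2 f, F [set g | d f g < r] &
    forall z, r <= w z -> `|e (ckfun f z) - e (l z)| <= r.
  move=> r0; have [f Ff] := cF r r0; exists f => // z rw.
  apply/ler_addgt0Pr => s s0.
  have [g [fg lg]] := filter_ex (filterI Ff ((cvg_distP _ _).1 (lP z) s s0)).
  apply: le_trans (ler_distD (e (ckfun g z)) _ _) _.
  by rewrite lerD// ltW//; [exact: d_lt|rewrite distrC].
(* On a compact neighbourhood [w] is bounded below, so the approximation is uniform there. *)
have cl : continuous l.
  move=> z A /ye[r r0 rA].
  have [U Uz [cU _]] := @lcZ z I.
  have {}Uz : nbhs z U by move: Uz; rewrite /within /=; apply: filterS => y; apply.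
  have [s s0 sw] := w_compact cU.
  have r30 : 0 < r / 3 by rewrite divr_gt0.
  have [|f Ff fl] := approx (Num.min (r / 3) s); first by rewrite lt_min r30 s0.
  have flU z' : U z' -> `|e (ckfun f z') - e (l z')| <= r / 3.
    move=> Uz'; have := fl z'; rewrite ge_min sw// orbT => /(_ isT).
    by rewrite le_min => /andP[].
  have cef : {for z, continuous (e \o ckfun f)}.
    apply: continuous_comp; first exact: ckfun_continuous.
    exact: ball_embedding_continuous.
  have := (continuous_at_distP _ _).1 cef _ r30.
  move=> H; apply: filterS (filterI Uz H) => z' [/= Uz' zz'].
  apply: rA => /=; have := flU _ (nbhs_singleton Uz); have := flU _ Uz'; move: zz'.
  rewrite !ltr_norml !ler_norml => /andP[? ?] /andP[? ?] /andP[? ?].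
  by apply/andP; split; lra.
exists (ck cl) => A /(Ck_nbhs_ballP ye)[K [r [cK r0] KA]].
have [s s0 sw] := w_compact cK.
have r30 : 0 < r / 3 by rewrite divr_gt0.
have [|f Ff fl] := approx (Num.min (r / 3) s); first by rewrite lt_min r30 s0.
apply: filterS Ff => g fg; apply: KA => z Kz; rewrite ckE.
have rw : Num.min (r / 3) s <= w z by rewrite ge_min sw// orbT.
have := d_lt fg rw; have := fl z rw; rewrite le_min lt_min => /andP[+ _] /andP[+ _].
rewrite !ltr_norml !ler_norml => /andP[? ?] /andP[? ?].
by apply/andP; split; lra.
Qed.

Lemma Ck_completely_metrizable : completely_metrizable R (Ck Z Y).
Proof.
apply: (@completely_metrizable_of_dist _ d) => //.
- move=> f; apply/eqP; rewrite eq_le d_ge0 andbT; apply: d_le => // z.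
  by rewrite subrr normr0 ge_min lexx orbT.
- move=> f g fg; apply: ckP => z; apply: einj; apply/eqP; rewrite -subr_eq0 -normr_le0.
  by have := le_d f g z; rewrite fg ge_min leNgt w0.
- move=> f g; congr (sup (_ `|` _)); apply/seteqP.
  by split => _ [z _ <-]; exists z => //; rewrite distrC.
Qed.

End metrizability.

Lemma lindelof_compact_cover (Z : topologicalType) :
  lindelof Z -> locally_compact [set: Z] ->
  exists g : nat -> set Z, [/\ forall n, open (g n), \bigcup_n g n = [set: Z] &
    forall n, exists2 C, compact C & g n `<=` C].
Proof.
move=> linZ lcZ.
have [|D [DC cD [Dop DT]]] := linZ [set U | open U /\ exists2 C, compact C & U `<=` C].
  split; first by move=> U [].
  rewrite -subTset => z _; have [U Uz [cU _]] := @lcZ z I.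
  have {}Uz : nbhs z U by move: Uz; rewrite /within /=; apply: filterS => y; apply.
  exists U° => //; split; first exact: open_interior.
  by exists U => //; exact: interior_subset.
have /pcard_leP/unsquash i := cD.
(* Since [i] is injective on [D], each union is a single member of [D] or empty; this pads a finite
   cover to a sequence. *)
exists (fun n => \bigcup_(V in [set V | D V /\ i V = n]) V); split.
- by move=> n; apply: bigcup_open => V [DV _]; exact: Dop.
- rewrite -subTset => z _; have : [set: Z] z by [].
  by rewrite -DT => -[V DV Vz]; exists (i V) => //; exists V.
- move=> n; have [[V [DV Vn]]|nV] := pselect (exists V, D V /\ i V = n); last first.
    exists set0; first exact: compact0.
    by move=> z [V DV _]; apply: nV; exists V.
  have [_ [C cC VC]] := DC V DV; exists C => // z [V' [DV' V'n] V'z]; apply: VC.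
  have <- // : V' = V.
  by apply: (@inj _ _ _ i _ _ (mem_set DV') (mem_set DV));
    exact: etrans V'n (esym Vn).
Qed.

Lemma lindelof_weight (R : realType) (Z : topologicalType) :
  lindelof Z -> locally_compact [set: Z] ->
  exists w : Z -> R, [/\ forall z, 0 < w z, forall z, w z <= 1,
    forall C, compact C -> exists2 r : R, 0 < r & forall z, C z -> r <= w z &
    forall r : R, 0 < r -> exists2 C, compact C & forall z, r <= w z -> C z].
Proof.
move=> linZ lcZ; have [g [gop gT gC]] := lindelof_compact_cover linZ lcZ.
have exn z : exists n, `[< g n z >].
  have : [set: Z] z by [].
  by rewrite -gT => -[n _ gz]; exists n; apply/asboolP.
(* The weight is 1/(n+1) for the first index [n] of a cover member containing [z]. This index is
   locally bounded, hence bounded on compact sets, and points of bounded index lie in finitely many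
   compact sets. *)
pose n z := ex_minn (exn z).
have gn z : g (n z) z by rewrite /n; case: ex_minnP => m /asboolP.
have nle z m : g m z -> (n z <= m)%N.
  by move=> gz; rewrite /n; case: ex_minnP => k _; apply; apply/asboolP.
exists (fun z => (n z).+1%:R^-1); split.
- by move=> z; rewrite invr_gt0.
- by move=> z; rewrite invf_le1// ler1n.
- move=> C cC.
  have : \forall N \near \oo, C `<=` [set z | (n z <= N)%N].
    apply: ((compact_near_coveringP C).1 cC _ \oo (fun N z => (n z <= N)%N)) => z Cz.
    exists (g (n z), [set N | (n z <= N)%N]).
      split; first exact: (open_nbhs_nbhs (conj (gop _) (gn z))).
      by exists (n z).
    by move=> [z' N]/= [gz' nN]; exact: leq_trans (nle _ _ gz') nN.
  move=> [N _ /(_ N (leqnn _)) CN]; exists N.+1%:R^-1; first by rewrite invr_gt0.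
  by move=> z Cz; rewrite lef_pV2 ?posrE// ler_nat ltnS; exact: CN.
- move=> r r0; have [C CP] := choice (fun n => (exists2P _ _).1 (gC n)).
  have [N _ Nr] := near_infty_natSinv_lt (PosNum r0).
  exists (\bigcup_(m in `I_N) C m).
    by apply: finite_bigcup_compact => [|m _]; [exact: finite_II|have [] := CP m].
  move=> z rz; exists (n z); last by have [_] := CP (n z); apply.
  rewrite /= ltnNge; apply/negP => Nn.
  by have := lt_le_trans (Nr (n z) Nn) rz; rewrite ltxx.
Qed.

(** * The implications between the conditions *)

Section equivalences.
Variables (R : realType) (X : topologicalType).

Lemma Ck_product (Y : topologicalType) (e : Y -> R) :
  ball_embedding e -> injective e -> closed (range e) ->
  sum_of_lindelof_locally_compact X -> product_of_completely_metrizable R (Ck X Y).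
Proof.
move=> ye einj ecl [I [Z [ZP XZ]]].
exists I, (fun i => Ck (Z i) Y); split.
  move=> i; have [linZ lcZ] := ZP i.
  have [w [w0 w1 w_compact compact_w]] := lindelof_weight R linZ lcZ.
  exact: (Ck_completely_metrizable ye einj ecl lcZ w0 w1 w_compact compact_w).
exact: homeomorphic_trans (Ck_homeomorphic Y XZ) (Ck_sigT Z Y).
Qed.

Lemma product_kR_space (Y : topologicalType) :
  product_of_completely_metrizable R Y -> kR_space R Y.
Proof.
move=> [I [Z [ZP [f [g [fK gK cf cg]]]]]] h ch.
have kZ : kR_space R (prod_topology Z).
  apply: prod_kR_space => i.
  exact: completely_metrizable_first_countable (ZP i).
have chg : continuous (h \o g).
  apply: kZ => K cK; apply/subspace_continuousP => z Kz.
  have cgK : compact (g @` K).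
    by apply: continuous_compact => //; exact: continuous_subspaceT.
  apply: (@within_continuous_cvg _ _ (g @` K) h (g @ within K (nbhs z)) _ (g z)).
  - exact: ch.
  - by exists z.
  - move=> A gA; exact: (@filterS (prod_topology Z) (nbhs z) (nbhs_filter z)
      (g @^-1` A) (fun y => K y -> A (g y)) (fun y Ay _ => Ay) (cg z A gA)).
  - by apply: (@filterS _ (nbhs z) (nbhs_filter z) setT) filterT => y _ Ky; exists y.
rewrite (_ : h = (h \o g) \o f); last by apply/funext => y /=; rewrite fK.
by move=> y; apply: continuous_comp; [exact: cf|exact: chg].
Qed.

Lemma Ck_real_product :
  sum_of_lindelof_locally_compact X -> product_of_completely_metrizable R (Ck X R).
Proof.
apply: (Ck_product (@ball_embedding_id R)) => //.
Qed.

Lemma Ck_unit_interval_product : sum_of_lindelof_locally_compact X ->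
  product_of_completely_metrizable R (Ck X (unit_interval R)).
Proof.
apply: (Ck_product (@ball_embedding_val R `[0, 1]%classic)).
  exact: val_inj.
rewrite (_ : range _ = `[0, 1]%classic); first exact: itv_closed.
apply/seteqP; split => [_ [x _ <-]|x x01]; first exact: set_valP.
by exists (exist _ x (mem_set x01)).
Qed.

(** Clamping values to the unit interval makes [Ck X (unit_interval R)] a retract of [Ck X R]. *)
Lemma ascoli_unit_interval :
  ascoli R (Ck X R) -> ascoli R (Ck X (unit_interval R)).
Proof.
pose I := unit_interval R.
pose clamp (t : R) := Num.max 0 (Num.min 1 t).
have clamp01 t : clamp t \in `[0, 1]%classic.
  by rewrite inE /= in_itv /= /clamp le_max lexx /= ge_max ler01 ge_min lexx.
have clampE (t : I) : clamp (val t) = val t.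
  have := set_valP t; rewrite /= in_itv /= => /andP[t0 t1].
  by rewrite /clamp min_r// max_r.
pose r t : I := exist _ (clamp t) (clamp01 t).
have cr : continuous r.
  move=> t A /(@ball_embedding_val R _ (r t))[e e0 eA].
  have cclamp : continuous clamp.
    move=> u; apply: (@continuous_max R R (cst 0) (fun t => Num.min 1 t)).
      exact: cvg_cst.
    by apply: (@continuous_min R R (cst 1) id); [exact: cvg_cst|exact: cvg_id].
  have := (continuous_at_distP _ _).1 (cclamp t) e e0.
  by apply: filterS => u tu; exact: eA.
have ci : continuous (val : I -> R) by exact: val_continuous.
have cif (f : Ck X I) : continuous (val \o ckfun f).
  by move=> x; apply: continuous_comp; [exact: ckfun_continuous|exact: ci].
have crf (f : Ck X R) : continuous (r \o ckfun f).
  by move=> x; apply: continuous_comp; [exact: ckfun_continuous|exact: cr].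
apply: (@retract_ascoli R _ _ (fun f => ck (cif f)) (fun f => ck (crf f))).
- by apply: (@Ck_comp_continuous X X I R id val) => // x A.
- by apply: (@Ck_comp_continuous X X R I id r) => // x A.
- by move=> f; apply: ckP => x; apply: val_inj; exact: clampE.
Qed.
End equivalences.

Theorem theorem1p6 (R : realType) (X : topologicalType)
    (hausX : hausdorff_space X) (paraX : paracompact X)
    (pctX : point_countable_type X) :
  [<-> locally_compact [set: X];
       sum_of_lindelof_locally_compact X;
       kR_space R (Ck X R);
       ascoli R (Ck X R);
       kR_space R (Ck X (unit_interval R));
       ascoli R (Ck X (unit_interval R))] /\
  (locally_compact [set: X] ->
     product_of_completely_metrizable R (Ck X R) /\
     product_of_completely_metrizable R (Ck X (unit_interval R))).
Proof.
have lc_sum := locally_compact_sum hausX paraX.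
have ascoli_lc := @ascoli_locally_compact R X hausX paraX pctX.
split; last first.
  by move=> /lc_sum sumX; split; [exact: Ck_real_product|exact: Ck_unit_interval_product].
tfae.
- exact: lc_sum.
- by move=> /(Ck_real_product R)/product_kR_space.
- exact: kR_space_ascoli.
(* The step from (iv) to (v) goes through (vi), (i) and (ii), and then through the product
   decomposition. *)
- move=> /ascoli_unit_interval/ascoli_lc/lc_sum sumX.
  exact/product_kR_space/Ck_unit_interval_product.
- exact: kR_space_ascoli.
- exact: ascoli_lc.
Qed.
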